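(* For every real number $X>0$ there exist infinitely many arithmetic hyperbolic $3$-manifolds $M$ with $\mathrm{sys}_2^{TG}(M)>X$.
   Context: Arithmetic hyperbolic $3$-manifolds. Let $k$ be a number field with a unique complex place $v$ and let $A$ be a quaternion algebra over $k$ ramified at all real places of $k$. Fix an identification $A\otimes_k k_v\cong \mathrm{M}_2(\mathbf{C})$; for a maximal order $\mathcal O$ of $A$, let $\Gamma_{\mathcal O}^1$ be the image in $\mathrm{PSL}_2(\mathbf{C})$ of the group of elements of $\mathcal O^*$ of reduced norm one. An arithmetic Kleinian group is a discrete subgroup of $\mathrm{PSL}_2(\mathbf{C})$ commensurable (up to conjugation) with some such $\Gamma_{\mathcal O}^1$. An arithmetic hyperbolic $3$-manifold is a quotient $M=\mathbf{H}^3/\Gamma$ with $\Gamma$ a torsion-free arithmetic Kleinian group. Totally geodesic $2$-systole. $\mathrm{sys}_2^{TG}(M)$ is the minimal area of an immersed totally geodesic surface of $M$ (finite area, properly immersed). It is defined when $M$ contains at least one such surface, so the statement concerns manifolds $M$ that contain such a surface. *)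

(* Defs.v *)
From HB Require Import structures.
From mathcomp Require Import all_boot all_order all_algebra all_field.
From mathcomp Require Import complex.
From mathcomp Require Import all_classical all_reals all_analysis.

Set Implicit Arguments.
Unset Strict Implicit.
Unset Printing Implicit Defensive.

Import Order.TTheory GRing.Theory Num.Theory.
Import ComplexField.Normc.

Local Open Scope classical_set_scope.
Local Open Scope complex_scope.
Local Open Scope ring_scope.

(** * Number fields and quaternion algebras *)

(* Real places of k are its embeddings in R; complex places are its non-real
   embeddings in R[i], taken up to complex conjugation. *)
Definition nonreal_embedding (R : realType) (k : fieldExtType rat)
    (tau : {rmorphism k -> R[i]}) : Prop :=
  exists x : k, complex.Im (tau x) != 0.

Definition unique_complex_place (R : realType) (k : fieldExtType rat)
    (tau : {rmorphism k -> R[i]}) : Prop :=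
  nonreal_embedding tau /\
  forall tau' : {rmorphism k -> R[i]}, nonreal_embedding tau' ->
    (forall x, tau' x = tau x) \/ (forall x, tau' x = conjc (tau x)).

Definition quaternion_algebra (k : fieldType) (A : falgType k) : Prop :=
  exists (a b : k) (i j : A),
    [/\ (a != 0) && (b != 0), i * i = a%:A, j * j = b%:A, j * i = - (i * j)
      & basis_of fullv [:: 1; i; j; i * j]].

(* The base change of A along sigma : k -> K, as the K-space of coordinates in
   a k-basis of A, multiplied by means of the structure constants of A. *)
Section BaseChange.
Variables (k : fieldType) (A : falgType k) (K : fieldType).
Variable sigma : {rmorphism k -> K}.

Definition base_change : Type := 'rV[K]_(\dim (fullv : {vspace A})).

Definition to_base_change (x : A) : base_change :=
  \row_l sigma (coord (vbasis fullv) l x).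

Definition base_change_mul (x y : base_change) : base_change :=
  \sum_i \sum_j
    (x 0 i * y 0 j) *: to_base_change ((vbasis fullv)`_i * (vbasis fullv)`_j).

Definition ramified : Prop :=
  forall x : base_change, x != 0 -> exists y : base_change,
    base_change_mul x y = to_base_change 1 /\
    base_change_mul y x = to_base_change 1.

(* By the universal property of the base change, a K-algebra isomorphism from
   it to 2 x 2 matrices is the K-linear extension of a sigma-semilinear ring
   morphism rho defined on A. *)
Definition matrix_identification (rho : {rmorphism A -> 'M[K]_2}) : Prop :=
  (forall c : k, rho c%:A = (sigma c)%:M) /\
  bijective (fun x : base_change => \sum_i x 0 i *: rho (vbasis fullv)`_i).

End BaseChange.

Definition algebraic_integer (k : fieldType) (x : k) : Prop :=
  integralOver (intr : int -> k) x.

(* A subring which is a finitely generated module over the integers of k and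
   spans A over k. *)
Definition is_order (k : fieldType) (A : falgType k) (O : set A) : Prop :=
  [/\ O 1, (forall x y, O x -> O y -> O (x * y)) &
   exists (n : nat) (e : n.-tuple A), <<e>>%VS = fullv /\
     forall x, O x <-> exists c : 'I_n -> k,
       (forall i, algebraic_integer (c i)) /\ x = \sum_i c i *: tnth e i].

Definition maximal_order (k : fieldType) (A : falgType k) (O : set A) : Prop :=
  is_order O /\ forall O' : set A, is_order O' -> O `<=` O' -> O' = O.

(** * Kleinian groups *)

(* A subgroup of PSL_2(C) is represented by its full preimage in SL_2(C), that
   is, by a subgroup of SL_2(C) containing -1. *)
Definition psl_subgroup (R : realType) (G : set 'M[R[i]]_2) : Prop :=
  [/\ (forall g, G g -> \det g = 1), G (- 1),
      (forall g h, G g -> G h -> G (g * h)) & (forall g, G g -> G g^-1)].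

Definition discrete_subgroup (R : realType) (G : set 'M[R[i]]_2) : Prop :=
  exists2 e : R, 0 < e & forall g, G g ->
    (forall i j, normc (g i j - (1 : 'M[R[i]]_2) i j) < e) -> g = 1.

(* Torsion-freeness is that of the image in PSL_2(C). *)
Definition psl_torsion_free (R : realType) (G : set 'M[R[i]]_2) : Prop :=
  forall g (n : nat), G g -> (0 < n)%N ->
    g ^+ n = 1 \/ g ^+ n = - 1 -> g = 1 \/ g = - 1.

Definition finite_index (R : realType) (G H : set 'M[R[i]]_2) : Prop :=
  H `<=` G /\
  exists s : seq 'M[R[i]]_2, (forall h, h \in s -> G h) /\
    forall g, G g -> exists2 h, h \in s & H (h^-1 * g).

Definition conjugate_set (R : realType) (u : 'M[R[i]]_2)
    (G : set 'M[R[i]]_2) : set 'M[R[i]]_2 :=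
  [set u * g * u^-1 | g in G].

Definition commensurable_up_to_conj (R : realType)
    (G H : set 'M[R[i]]_2) : Prop :=
  exists2 u : 'M[R[i]]_2, \det u = 1 &
    finite_index G (G `&` conjugate_set u H) /\
    finite_index (conjugate_set u H) (G `&` conjugate_set u H).

(* The reduced norm of x is the determinant of rho x, for rho an
   identification of a base change of A with 2 x 2 matrices. *)
Definition norm_one_group (R : realType) (k : fieldType) (A : falgType k)
    (rho : {rmorphism A -> 'M[R[i]]_2}) (O : set A) : set 'M[R[i]]_2 :=
  [set rho x | x in [set x | [/\ O x, x \is a GRing.unit, O x^-1
                               & \det (rho x) = 1]]].

Definition arithmetic_kleinian (R : realType) (G : set 'M[R[i]]_2) : Prop :=
  [/\ psl_subgroup G, discrete_subgroup G &
   exists (k : fieldExtType rat) (tau : {rmorphism k -> R[i]})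
          (A : falgType k) (rho : {rmorphism A -> 'M[R[i]]_2}) (O : set A),
     [/\ unique_complex_place tau,
         quaternion_algebra A /\
           (forall sigma : {rmorphism k -> R}, ramified A sigma),
         matrix_identification tau rho,
         maximal_order O
       & commensurable_up_to_conj G (norm_one_group rho O)]].

(** * Hyperbolic plane and hyperbolic space, upper half-space models *)

Definition arcosh (R : realType) (u : R) : R := ln (u + Num.sqrt (u ^+ 2 - 1)).

Definition H2 (R : realType) : Type := {p : R * R | 0 < p.2}.

Definition dist2 (R : realType) (p q : H2 R) : R :=
  let: (x, y) := val p in let: (x', y') := val q in
  arcosh (1 + ((x - x') ^+ 2 + (y - y') ^+ 2) / (2 * y * y')).

(* The sigma-algebra has to be chosen explicitly: the one found by default on
   R * R is not syntactically the domain of the product Lebesgue measure. *)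
Definition borel2 (R : realType)
    (B : set (measurableTypeR R * measurableTypeR R)) : Prop := measurable B.

Definition area2 (R : realType)
    (B : set (measurableTypeR R * measurableTypeR R)) : \bar R :=
  \int[(@lebesgue_measure R \x @lebesgue_measure R)%E]_(p in B)
    ((p.2 ^- 2)%:E).

Definition H3 (R : realType) : Type := {p : R[i] * R | 0 < p.2}.

Definition dist3 (R : realType) (p q : H3 R) : R :=
  let: (z, t) := val p in let: (z', t') := val q in
  arcosh (1 + (normc (z - z') ^+ 2 + (t - t') ^+ 2) / (2 * t * t')).

(* Poincare extension of the Moebius action of SL_2(C). *)
Definition poincare (R : realType) (g : 'M[R[i]]_2) (p : R[i] * R) : R[i] * R :=
  let: (z, t) := p in
  let a := g 0 0 in let b := g 0 1 in let c := g 1 0 in let d := g 1 1 in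
  let den := normc (c * z + d) ^+ 2 + normc c ^+ 2 * t ^+ 2 in
  (((a * z + b) * conjc (c * z + d) + a * conjc c * (t ^+ 2)%:C) / den%:C,
   t / den).

(* Equality of the images of p and q in the quotient of H3 by G. *)
Definition orbit3 (R : realType) (G : set 'M[R[i]]_2) (p q : H3 R) : Prop :=
  exists2 g, G g & val q = poincare g (val p).

(** * Hyperbolic 3-manifolds and their totally geodesic surfaces *)

(* The manifold M is the quotient of H3 by G. *)
Definition arithmetic_hyperbolic_3manifold (R : realType)
    (G : set 'M[R[i]]_2) : Prop :=
  arithmetic_kleinian G /\ psl_torsion_free G.

(* Isometries between quotients of H3 are given by their lifts to H3. *)
Definition isometric_manifolds (R : realType) (G G' : set 'M[R[i]]_2) : Prop :=
  exists phi : H3 R -> H3 R,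
    [/\ bijective phi, (forall p q, dist3 (phi p) (phi q) = dist3 p q)
      & forall p q, orbit3 G p q <-> orbit3 G' (phi p) (phi q)].

(* Groups of isometries of H2 acting freely and properly discontinuously; by
   uniformization, complete connected hyperbolic surfaces, orientable or not,
   are the quotients of H2 by such groups. *)
Definition surface_group (R : realType) (L : set (H2 R -> H2 R)) : Prop :=
  [/\ L id, (forall f g, L f -> L g -> L (f \o g)),
      (forall f, L f -> exists g, [/\ L g, cancel f g & cancel g f]),
      (forall f, L f -> forall p q, dist2 (f p) (f q) = dist2 p q)
    & forall p, exists2 e : R, 0 < e &
        forall f, L f -> dist2 p (f p) < e -> f = id].

(* Area of the quotient of H2 by L, as the supremum of the areas of the Borel
   sets that map injectively to the quotient; Borel fundamental domains attain
   it. *)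
Definition surface_area (R : realType) (L : set (H2 R -> H2 R)) : \bar R :=
  ereal_sup [set area2 [set val p | p in B] | B in
    [set B : set (H2 R) | borel2 [set val p | p in B] /\
       forall f p, L f -> B p -> B (f p) -> f p = p]].

(* F : H2 -> H3 is the lift of a totally geodesic immersion of the quotient of
   H2 by L in the quotient of H3 by G: it descends to the quotients, and maps
   geodesics of H2 isometrically to geodesics of H3. *)
Definition totally_geodesic_immersion (R : realType) (L : set (H2 R -> H2 R))
    (G : set 'M[R[i]]_2) (F : H2 R -> H3 R) : Prop :=
  (forall f p, L f -> orbit3 G (F p) (F (f p))) /\
  (forall p q, dist3 (F p) (F q) = dist2 p q).

(* Properness of the induced map: the preimage of a ball is bounded.  Closed
   balls are compact in these quotients. *)
Definition proper_immersion (R : realType) (L : set (H2 R -> H2 R))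
    (G : set 'M[R[i]]_2) (F : H2 R -> H3 R) : Prop :=
  forall (o3 : H3 R) (o2 : H2 R) (r : R), exists r' : R, forall p : H2 R,
    (exists2 q, orbit3 G (F p) q & dist3 o3 q <= r) ->
    exists2 f, L f & dist2 o2 (f p) <= r'.

Definition tg_surface_areas (R : realType) (G : set 'M[R[i]]_2) : set (\bar R) :=
  [set a | exists (L : set (H2 R -> H2 R)) (F : H2 R -> H3 R),
    [/\ surface_group L, totally_geodesic_immersion L G F,
        proper_immersion L G F, a = surface_area L & (a < +oo)%E]].

(* The infimum is a minimum: by Gauss-Bonnet, areas of hyperbolic surfaces of
   finite area are multiples of 2 pi.  It is +oo if there is no surface. *)
Definition sys2TG (R : realType) (G : set 'M[R[i]]_2) : \bar R :=
  ereal_inf (tg_surface_areas G).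

(* Main.v *)
(* Let Gam N be the preimage in SL_2(Z[i]) of the scalars +-1 modulo N, and M = H3 / Gam N, for N = N0 3^n.
   The distance by which g in Gam N, g <> +-1, moves a point of height t is bounded below
   in terms of N and t only: either |tr g| >= N^2 - 2, or g = +-(1 + N m) with m nilpotent and integral.

   A totally geodesic plane leaves every horoball, so up to SL_2(Z[i]), which normalizes Gam N, it has a point
   whose height is between 1/2 and 2. Around this point a rectangle of area > X in the plane injects
   into every surface covered by the plane, as soon as N is large. The same displacement estimate at
   height 1, against the translation by N at height >= 1/2, shows that the maximal injectivity radii
   of the manifolds are distinct, whence they are pairwise non-isometric.

   The quotient of the vertical plane over R by the real points of Gam N is a totally geodesic surface of
   finite area: SL_2(Z) moves every point into the box |x| <= 1/2, y >= 1/2, of finite area, and there are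
   finitely many classes modulo N. The arithmetic data are k = Q(i), which has no real place, A = M_2(k)
   and the maximal order of matrices with integral entries. *)
From HB Require Import structures.
Require Import Defs.
From mathcomp Require Import all_boot all_order all_algebra all_field.
From mathcomp Require Import complex.
From mathcomp Require Import all_classical all_reals all_analysis.
From mathcomp Require Import measurable_realfun.
From mathcomp Require Import ring lra zify.

Set Implicit Arguments.
Unset Strict Implicit.
Unset Printing Implicit Defensive.

Import Order.TTheory GRing.Theory Num.Theory.
Import ComplexField.Normc.
Import numFieldNormedType.Exports.

Local Open Scope classical_set_scope.
Local Open Scope complex_scope.
Local Open Scope ring_scope.

(** * The upper half-space and its isometries *)

Section HyperbolicGeometry.
Variable R : realType.
Implicit Types (g h : 'M[R[i]]_2) (p q : R[i] * R) (z w : R[i]).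

(** The cusps shape the proof. A parabolic element of level N moves a point of large height t by
    about N / t only, so no positive lower bound on displacements holds on all of M, and the
    estimate says something about a plane only once one of its points is found at bounded height. A
    surface is seen through its distance-preserving lift F: a deck transformation f that moves b
    little yields an element of Gam N that moves F b little, and the estimate forces this element to
    be +-1. Distances are handled through their hyperbolic cosine, which is rational in the
    coordinates. The ratio 3 between successive levels separates the manifolds: the upper bound 1 +
    2 N^2, valid at every point for level N, stays below the lower bound 1 + (3 N)^2 / 2 at height 1
    for level 3 N. The invariance of the area under isometries is reduced to Fubini and to
    one-dimensional Lebesgue measure by coordinates in which isometries become shears. *)

Lemma matrix2P (T : Type) (A B : 'M[T]_2) :
  A 0 0 = B 0 0 -> A 0 1 = B 0 1 -> A 1 0 = B 1 0 -> A 1 1 = B 1 1 -> A = B.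
Proof.
move=> h00 h01 h10 h11; apply/matrixP => i j.
have [-> | ->] : i = 0 \/ i = 1 by case: i => [[|[|//]]] ?; [left|right]; exact/val_inj.
  by have [-> | ->] : j = 0 \/ j = 1 by case: j => [[|[|//]]] ?; [left|right]; exact/val_inj.
by have [-> | ->] : j = 0 \/ j = 1 by case: j => [[|[|//]]] ?; [left|right]; exact/val_inj.
Qed.

Lemma mulmx2E (S : pzRingType) (A B : 'M[S]_2) i j :
  (A * B) i j = A i 0 * B 0 j + A i 1 * B 1 j.
Proof. by rewrite mxE !big_ord_recl big_ord0 addr0; congr (_ + A i _ * B _ j); exact: val_inj. Qed.

Lemma mxtrace2 (S : pzRingType) (A : 'M[S]_2) : \tr A = A 0 0 + A 1 1.
Proof. by rewrite /mxtrace !big_ord_recl big_ord0 addr0; congr (_ + A _ _); exact: val_inj. Qed.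

Definition mx2 (S : Type) (a b c d : S) : 'M[S]_2 :=
  \matrix_(i, j) if i == 0 then (if j == 0 then a else b) else (if j == 0 then c else d).

Lemma mx2_eta (S : Type) (A : 'M[S]_2) : A = mx2 (A 0 0) (A 0 1) (A 1 0) (A 1 1).
Proof. by apply: matrix2P; rewrite !mxE. Qed.

Lemma mul_mx2 (S : pzRingType) (a b c d a' b' c' d' : S) :
  mx2 a b c d * mx2 a' b' c' d' =
  mx2 (a * a' + b * c') (a * b' + b * d') (c * a' + d * c') (c * b' + d * d').
Proof. by apply: matrix2P; rewrite mulmx2E !mxE. Qed.

Lemma det2E (S : comPzRingType) (A : 'M[S]_2) : \det A = A 0 0 * A 1 1 - A 0 1 * A 1 0.
Proof.
rewrite (expand_det_row _ 0) !big_ord_recl big_ord0 addr0 /cofactor !det_mx11 !mxE /=.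
by rewrite addn0 expr0 expr1 mul1r mulN1r mulrN; congr (_ * A _ _ - A _ _ * A _ _); exact: val_inj.
Qed.

Lemma det_mx2 (S : comPzRingType) (a b c d : S) : \det (mx2 a b c d) = a * d - b * c.
Proof. by rewrite det2E !mxE. Qed.

Lemma normc_sq z : normc z ^+ 2 = complex.Re z ^+ 2 + complex.Im z ^+ 2.
Proof. by case: z => a b /=; rewrite sqr_sqrtr // addr_ge0 // sqr_ge0. Qed.

Lemma normc_sqC z : ((normc z ^+ 2)%:C : R[i]) = z * conjc z.
Proof.
rewrite normc_sq; case: z => a b /=; apply/eqP; rewrite eq_complex /=.
by apply/andP; split; apply/eqP; ring.
Qed.


(** Stands for the inverse on SL_2: its entries are those of [A] up to sign, so integrality and
    congruences pass to inverses at once. *)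
Definition adj2 (S : pzRingType) (A : 'M[S]_2) : 'M[S]_2 :=
  mx2 (A 1 1) (- A 0 1) (- A 1 0) (A 0 0).

Lemma adj2M (S : comPzRingType) (A B : 'M[S]_2) : adj2 (A * B) = adj2 B * adj2 A.
Proof. by apply: matrix2P; rewrite /adj2 !mulmx2E !mxE /=; ring. Qed.

Lemma mul_adj2 (S : comPzRingType) (A : 'M[S]_2) : A * adj2 A = (\det A)%:M.
Proof. by apply: matrix2P; rewrite /adj2 ?det2E !mulmx2E !mxE /= ?mulr1n ?mulr0n; ring. Qed.

Lemma mul_adj2l (S : comPzRingType) (A : 'M[S]_2) : adj2 A * A = (\det A)%:M.
Proof. by apply: matrix2P; rewrite /adj2 ?det2E !mulmx2E !mxE /= ?mulr1n ?mulr0n; ring. Qed.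

Lemma invr_adj2 (S : comUnitRingType) (A : 'M[S]_2) : \det A = 1 -> A^-1 = adj2 A.
Proof.
move=> dA; have uA : A \is a GRing.unit by rewrite unitmxE dA unitr1.
by apply: (mulrI uA); rewrite divrr // mul_adj2 dA.
Qed.

Definition cosh3 p q : R :=
  1 + (normc (p.1 - q.1) ^+ 2 + (p.2 - q.2) ^+ 2) / (2 * p.2 * q.2).

(* The upper half-space as the space of positive Hermitian matrices of determinant 1, on which g
   acts by h |-> g h g^*. *)
Definition herm p : 'M[R[i]]_2 :=
  mx2 ((normc p.1 ^+ 2 + p.2 ^+ 2)%:C / (p.2)%:C) (p.1 / (p.2)%:C) (conjc p.1 / (p.2)%:C) ((p.2)%:C)^-1.

Definition star2 g : 'M[R[i]]_2 :=
  mx2 (conjc (g 0 0)) (conjc (g 1 0)) (conjc (g 0 1)) (conjc (g 1 1)).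

Lemma star2M g h : star2 (g * h) = star2 h * star2 g.
Proof. by apply: matrix2P; rewrite /star2 !mulmx2E !mxE /= !rmorphD /= !rmorphM /=; ring. Qed.

Lemma det_star2 g : \det (star2 g) = conjc (\det g).
Proof. by rewrite !det2E !mxE /= rmorphB /= !rmorphM /=; ring. Qed.

Lemma realC_eq0 (x : R) : (x%:C == 0 :> R[i]) = (x == 0).
Proof. by rewrite -(rmorph0 (real_complex R)) (inj_eq (@complexI _)). Qed.

Lemma herm_inj p q : p.2 != 0 -> q.2 != 0 -> herm p = herm q -> p = q.
Proof.
case: p q => [z t] [w u] /= t0 u0 e.
have := erefl (herm (z, t) 1 1); rewrite {1}e !mxE /= => /invr_inj/complexI ut.
have := erefl (herm (z, t) 0 1); rewrite {1}e !mxE /= ut => /mulIf -> //.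
by rewrite invr_eq0 realC_eq0.
Qed.

(** The determinant is a Lorentz form on Hermitian 2 x 2 matrices, and half the trace of
    [h * adj2 h'] is its polarization. Points are unit vectors for it, so this is the distance
    formula of the hyperboloid model. *)
Lemma cosh3E p q : p.2 != 0 -> q.2 != 0 ->
  (cosh3 p q)%:C = 2^-1 * \tr (herm p * adj2 (herm q)).
Proof.
case: p q => [z t] [w u] /= t0 u0; rewrite mxtrace2 !mulmx2E !mxE /=.
rewrite /cosh3 /= rmorphD rmorphM /= !rmorphD /= !rmorphXn /= fmorphV !rmorphM /= rmorph1 rmorphB /= rmorph_nat.
rewrite -!(rmorphXn (real_complex R)) /= !normc_sqC !rmorphXn /= !rmorphB /=.
by field; rewrite !realC_eq0 t0 u0.
Qed.

Definition mobden g p : R :=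
  normc (g 1 0 * p.1 + g 1 1) ^+ 2 + normc (g 1 0) ^+ 2 * p.2 ^+ 2.

Lemma mobden_gt0 g p : \det g = 1 -> 0 < p.2 -> 0 < mobden g p.
Proof.
move=> dg p0.
have t2 : 0 <= normc (g 1 0) ^+ 2 * p.2 ^+ 2 by apply: mulr_ge0; exact: sqr_ge0.
have ge0 : 0 <= mobden g p by apply: addr_ge0 => //; exact: sqr_ge0.
rewrite lt_neqAle ge0 andbT eq_sym; apply/negP; rewrite /mobden paddr_eq0 ?sqr_ge0 //.
rewrite sqrf_eq0 mulf_eq0 !sqrf_eq0 (gt_eqF p0) orbF => /andP[/eqP/eq0_normc e /eqP/eq0_normc c0].
move: dg e; rewrite det2E c0 mul0r add0r => + d0.
by rewrite d0 !mulr0 subrr => /eqP; rewrite eq_sym oner_eq0.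
Qed.

Lemma poincareE g p : poincare g p =
  (((g 0 0 * p.1 + g 0 1) * conjc (g 1 0 * p.1 + g 1 1)
    + g 0 0 * conjc (g 1 0) * (p.2 ^+ 2)%:C) / (mobden g p)%:C, p.2 / mobden g p).
Proof. by case: p. Qed.

Lemma mobdenC g p : (mobden g p)%:C = (g 1 0 * p.1 + g 1 1) * conjc (g 1 0 * p.1 + g 1 1)
   + g 1 0 * conjc (g 1 0) * ((p.2)%:C) ^+ 2.
Proof. by rewrite /mobden rmorphD /= normc_sqC rmorphM /= normc_sqC rmorphXn. Qed.

Lemma conjcM z w : conjc (z * w) = conjc z * conjc w. Proof. exact: rmorphM. Qed.
Lemma conjcD z w : conjc (z + w) = conjc z + conjc w. Proof. exact: rmorphD. Qed.
Lemma conjcN z : conjc (- z) = - conjc z. Proof. exact: rmorphN. Qed.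
Lemma realcV (x : R) : (x^-1)%:C = (x%:C)^-1 :> R[i]. Proof. exact: fmorphV. Qed.
Lemma realcM (x y : R) : (x * y)%:C = x%:C * y%:C :> R[i]. Proof. exact: rmorphM. Qed.
Lemma realcD (x y : R) : (x + y)%:C = x%:C + y%:C :> R[i]. Proof. exact: rmorphD. Qed.
Lemma realcX (x : R) n : (x ^+ n)%:C = x%:C ^+ n :> R[i]. Proof. exact: rmorphXn. Qed.

Lemma herm_poincare g p : \det g = 1 -> 0 < p.2 ->
  herm (poincare g p) = g * herm p * star2 g.
Proof.
move=> dg p0; have := mobden_gt0 dg p0; have := mobdenC g p.
rewrite poincareE; move: (mobden g p) => D DE D0.
have t0 : (p.2)%:C != 0 :> R[i] by rewrite realC_eq0 gt_eqF.
have D0' : D%:C != 0 :> R[i] by rewrite realC_eq0 gt_eqF.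
have dg' : conjc (g 0 0) * conjc (g 1 1) - conjc (g 0 1) * conjc (g 1 0) = 1.
  by rewrite -!rmorphM -rmorphB /= -det2E dg rmorph1.
move: dg; rewrite det2E => dg.
have hermC (w : R[i]) (u : R) : herm (w, u) = mx2 ((w * conjc w + u%:C ^+ 2) / u%:C)
   (w / u%:C) (conjc w / u%:C) (u%:C)^-1.
  by rewrite /herm /= rmorphD /= normc_sqC rmorphXn.
case: p DE p0 t0 => [z t] /= DE p0 t0.
have cden : conjc (g 1 0 * z + g 1 1) = conjc (g 1 0) * conjc z + conjc (g 1 1).
  by rewrite rmorphD rmorphM.
rewrite {}cden in DE *; rewrite -[in X in herm X]mulrA.
set num := (X in (X / _, _)).
have cnum : conjc num = (conjc (g 0 0) * conjc z + conjc (g 0 1)) * (g 1 0 * z + g 1 1)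
   + conjc (g 0 0) * (g 1 0 * (t%:C)^+2).
  by rewrite /num -realcX !(conjcM, conjcD, conjcK) conjc_real.
have cD : conjc (num / D%:C) = conjc num / D%:C by rewrite conjcM conjc_inv conjc_real.
have tD : (t / D)%:C = t%:C / D%:C by rewrite realcM realcV.
rewrite !hermC cD tD cnum /num realcX.
rewrite /star2 [X in _ = X * _ * _]mx2_eta !mul_mx2.
move: dg dg' D0' t0 DE; clear; move: (D%:C) (t%:C) (g 0 0) (g 0 1) (g 1 0) (g 1 1) (conjc (g 0 0)) (conjc (g 0 1)) (conjc (g 1 0)) (conjc (g 1 1)) (conjc z).
move=> E T a b c d a' b' c' d' z' dg dg' E0 T0 DE.
apply: matrix2P; rewrite !mxE /=; last first.
- by rewrite invf_div DE; field.
- by field; rewrite T0 E0.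
- by field; rewrite T0 E0.
(* Scaled by [T], the image matrix has the numerator of the new point off the diagonal and [E] as
   its lower entry. [key] computes its determinant as [T ^+ 2] times the two unit determinants,
   which ties the upper entry to the other three. *)
- have key : ((a * z + b) * (c' * z' + d') + a * (c' * T ^+ 2)) *
    ((a' * z' + b') * (c * z + d) + a' * (c * T ^+ 2)) + T ^+ 2 * ((a * d - b * c) * (a' * d' - b' * c'))
   = ((c * z + d) * (c' * z' + d') + c * c' * T ^+ 2) *
     ((a * z + b) * (a' * z' + b') + a * a' * T ^+2) by ring.
  move: key; rewrite dg dg' -DE !mulr1 => key.
  transitivity (((a * z + b) * (a' * z' + b') + a * a' * T ^+ 2) / T); last by field.
  apply: (@mulIf _ (E * T)); first by rewrite mulf_neq0.
  transitivity ((((a * z + b) * (c' * z' + d') + a * (c' * T ^+ 2)) *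
     ((a' * z' + b') * (c * z + d) + a' * (c * T ^+ 2)) + T ^+ 2)).
    by field; rewrite T0 E0.
  by apply: (etrans key); field.
Qed.

Lemma poincare_gt0 g p : \det g = 1 -> 0 < p.2 -> 0 < (poincare g p).2.
Proof. by move=> dg p0; rewrite poincareE /= divr_gt0 // mobden_gt0. Qed.

(** On Hermitian matrices this is associativity of the product, and [herm_inj] brings it back to
    points. *)
Lemma poincareM g h p : \det g = 1 -> \det h = 1 -> 0 < p.2 ->
  poincare (g * h) p = poincare g (poincare h p).
Proof.
move=> dg dh p0; have h0 := poincare_gt0 dh p0.
have dgh : \det (g * h) = 1 by rewrite -mulmxE det_mulmx dg dh mulr1.
apply: herm_inj; rewrite ?gt_eqF ?poincare_gt0 //.
by rewrite !herm_poincare // star2M !mulrA.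
Qed.

Lemma mx2E (S : Type) (a b c d : S) : (mx2 a b c d 0 0 = a) * (mx2 a b c d 0 1 = b) *
  (mx2 a b c d 1 0 = c) * (mx2 a b c d 1 1 = d).
Proof. by rewrite !mxE. Qed.

Lemma mx2_1 (S : pzRingType) : 1 = mx2 1 0 0 1 :> 'M[S]_2.
Proof. by apply: matrix2P; rewrite !mxE. Qed.

Lemma mx2_N (S : pzRingType) (a b c d : S) : - mx2 a b c d = mx2 (- a) (- b) (- c) (- d).
Proof. by apply: matrix2P; rewrite !mxE. Qed.

Lemma poincareN g p : poincare (- g) p = poincare g p.
Proof.
have e : mobden (- g) p = mobden g p by rewrite /mobden !mxE mulNr -opprD !normcN.
by rewrite !poincareE e !mxE !mulNr -!opprD !conjcN !(mulNr, mulrN, opprK).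
Qed.

Lemma poincare1 p : poincare 1 p = p.
Proof.
case: p => z t; rewrite poincareE /mobden mx2_1 !mx2E !mul0r !add0r normc0 normc1.
by rewrite conjc1 conjc0 mul1r !addr0 !mulr1 mulr0 mul0r addr0 expr1n expr0n mul0r addr0 !divr1.
Qed.

Lemma cosh3_poincare g p q : \det g = 1 -> 0 < p.2 -> 0 < q.2 ->
  cosh3 (poincare g p) (poincare g q) = cosh3 p q.
Proof.
move=> dg p0 q0; apply: complexI; rewrite !cosh3E ?gt_eqF ?poincare_gt0 //.
rewrite !herm_poincare // !adj2M; congr (_ * _).
rewrite -!mulrA [star2 g * _]mulrA mul_adj2 det_star2 dg rmorph1 mul1r.
rewrite [LHS]mxtrace_mulC.
have -> : herm p * (adj2 (herm q) * adj2 g) *m g = herm p * (adj2 (herm q) * (adj2 g * g)).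
  by rewrite mulmxE !mulrA.
by rewrite mul_adj2l dg mulr1.
Qed.
Lemma cosh3_ge1 p q : 0 < p.2 -> 0 < q.2 -> 1 <= cosh3 p q.
Proof.
move=> p0 q0; rewrite lerDl divr_ge0 //; first by rewrite addr_ge0 // sqr_ge0.
by rewrite !mulr_ge0 // ltW.
Qed.

Lemma cosh3_sym p q : cosh3 p q = cosh3 q p.
Proof.
by rewrite /cosh3 -(opprB p.1) normcN -(opprB p.2) sqrrN mulrAC.
Qed.

Lemma cosh3_eq1 p q : 0 < p.2 -> 0 < q.2 -> cosh3 p q = 1 -> p = q.
Proof.
case: p q => [z t] [w u] /= t0 u0 /eqP; rewrite /cosh3 /= -subr_eq0 addrC addKr mulf_eq0.
rewrite invr_eq0 !mulf_eq0 pnatr_eq0 (gt_eqF t0) (gt_eqF u0) !orbF.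
rewrite paddr_eq0 ?sqr_ge0 // !sqrf_eq0 => /andP[/eqP/eq0_normc/eqP].
by rewrite !subr_eq0 => /eqP -> /eqP ->.
Qed.

(** Discarding the horizontal term leaves t^2 + u^2 <= 2 K t u for the two heights t and u. *)
Lemma cosh3_height p q (K : R) : 0 < p.2 -> 0 < q.2 -> cosh3 p q <= K -> p.2 <= 2 * K * q.2.
Proof.
case: p q => [z t] [w u] /= t0 u0; rewrite /cosh3 /= => h.
have h1 : normc (z - w) ^+ 2 + (t - u) ^+ 2 <= (K - 1) * (2 * t * u).
  by rewrite -ler_pdivrMr ?mulr_gt0 //; lra.
have h2 := sqr_ge0 (normc (z - w)); have h3 : 0 <= u ^+ 2 by exact: sqr_ge0.
have : t * t <= (2 * K * u) * t by nra.
by rewrite ler_pM2r.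
Qed.

Lemma arcosh_lt (u v : R) : 1 <= u -> u < v -> arcosh u < arcosh v.
Proof.
move=> u1 uv; rewrite /arcosh ltr_ln ?posrE.
- rewrite ltr_leD // ler_sqrt; first by nra.
  by nra.
- by rewrite ltr_wpDr ?sqrtr_ge0 //; lra.
- by rewrite ltr_wpDr ?sqrtr_ge0 //; lra.
Qed.

Lemma arcosh_le (u v : R) : 1 <= u -> 1 <= v -> (arcosh u <= arcosh v) = (u <= v).
Proof.
move=> u1 v1; have [uv|vu] := leP u v.
  move: uv; rewrite le_eqVlt => /predU1P[->|uv]; first by rewrite lexx.
  by have /ltW -> := arcosh_lt u1 uv.
by apply/negbTE; rewrite -ltNge arcosh_lt.
Qed.

Lemma arcosh_inj (u v : R) : 1 <= u -> 1 <= v -> arcosh u = arcosh v -> u = v.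
Proof. by move=> u1 v1 e; apply/eqP; rewrite eq_le -(arcosh_le u1 v1) -(arcosh_le v1 u1) e lexx. Qed.

Lemma arcosh_le_exp (u r : R) : 1 <= u -> arcosh u <= r -> u <= expR r.
Proof.
move=> u1; rewrite /arcosh -ler_expR lnK; last first.
  by rewrite posrE; have := sqrtr_ge0 (u ^+ 2 - 1); lra.
by apply: le_trans; rewrite lerDl sqrtr_ge0.
Qed.

(* The right-hand side is half the squared Frobenius norm of u^-1 g u, where u = [[t, z], [0, 1]]
   moves (0, 1) to p = (z, t). *)
Lemma cosh3_displacement g p : \det g = 1 -> 0 < p.2 ->
  cosh3 p (poincare g p) = 2^-1 *
    (normc (g 0 0 - p.1 * g 1 0) ^+ 2 + normc (g 1 0 * p.1 + g 1 1) ^+ 2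
     + normc (g 1 0 * (p.2)%:C) ^+ 2
     + normc ((g 0 0 * p.1 + g 0 1 - p.1 * (g 1 0 * p.1 + g 1 1)) / (p.2)%:C) ^+ 2).
Proof.
move=> dg p0; apply: complexI; rewrite cosh3E ?gt_eqF ?poincare_gt0 // herm_poincare //.
have t0 : (p.2)%:C != 0 :> R[i] by rewrite realC_eq0 gt_eqF.
rewrite [in RHS]realcM realcV -[2%:C]/(2%:R%:C) rmorph_nat; congr (_ * _).
rewrite !realcD !normc_sqC mxtrace2 !mulmx2E /adj2 /star2 /herm !mx2E !mulmx2E !mx2E.
case: p p0 t0 => [z t] /= p0 t0.
rewrite !realcD !normc_sqC !realcX.
rewrite !(conjcN, conjcM, conjcD, conjc_inv, conjc_real).
move: t0; move: (t%:C) (g 0 0) (g 0 1) (g 1 0) (g 1 1) (conjc (g 0 0)) (conjc (g 0 1)) (conjc (g 1 0)) (conjc (g 1 1)) (conjc z) => T a b c d a' b' c' d' z' T0.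
by field.
Qed.

(* In the hyperboloid model the midpoint of P and Q is a multiple of P + Q. *)
Lemma lorentz_midpoint (a x y b a' x' y' b' a0 x0 y0 b0 c : R) :
  a * b = 1 + x ^+ 2 + y ^+ 2 -> a' * b' = 1 + x' ^+ 2 + y' ^+ 2 ->
  a0 * b0 = 1 + x0 ^+ 2 + y0 ^+ 2 ->
  a * b0 + b * a0 = 2 * (c + x * x0 + y * y0) ->
  a' * b0 + b' * a0 = 2 * (c + x' * x0 + y' * y0) ->
  a * b' + b * a' = 2 * (2 * c ^+ 2 - 1 + x * x' + y * y') ->
  a + a' = 2 * c * a0.
Proof.
move=> h h' h0 e e' f.
(* (A, B, X, Y) is the vector P + Q - 2 c M: [n0] says that it is isotropic and [o0] that it is
   orthogonal to the timelike vector M, and only 0 is both. *)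
pose A := a + a' - 2 * c * a0; pose B := b + b' - 2 * c * b0.
pose X := x + x' - 2 * c * x0; pose Y := y + y' - 2 * c * y0.
have n0 : A * B = X ^+ 2 + Y ^+ 2.
  transitivity (a * b + a' * b' + 4 * c ^+ 2 * (a0 * b0) + (a * b' + b * a')
    - 2 * c * (a * b0 + b * a0) - 2 * c * (a' * b0 + b' * a0)); first by rewrite /A /B; ring.
  by rewrite h h' h0 e e' f /X /Y; ring.
have o0 : A * b0 + B * a0 = 2 * (X * x0 + Y * y0).
  transitivity ((a * b0 + b * a0) + (a' * b0 + b' * a0) - 4 * c * (a0 * b0)).
    by rewrite /A /B; ring.
  by rewrite h0 e e' /X /Y; ring.
suff : A = 0 by rewrite /A; lra.
move: A B X Y n0 o0 h0 => A B X Y n0 o0 h0; clear -n0 o0 h0.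
have AB0 : 0 <= A * B by rewrite n0 addr_ge0 // sqr_ge0.
have key : (A * b0 - B * a0) ^+ 2 + 4 * (A * B) + 4 * (X * y0 - Y * x0) ^+ 2 = 0.
  transitivity ((A * b0 + B * a0) ^+ 2 - 4 * (A * B) * (a0 * b0) + 4 * (A * B) + 4 * (X * y0 - Y * x0) ^+ 2).
    by ring.
  by rewrite o0 h0 n0; ring.
have s1 := sqr_ge0 (A * b0 - B * a0); have s2 := sqr_ge0 (X * y0 - Y * x0).
have AB : A * B = 0 by lra.
have /eqP : (A * b0 - B * a0) ^+ 2 = 0 by lra.
rewrite sqrf_eq0 subr_eq0 => /eqP e.
have : A ^+ 2 * b0 = 0 by rewrite expr2 -mulrA e mulrA AB mul0r.
move=> /eqP; rewrite mulf_eq0 sqrf_eq0 => /orP[/eqP //|/eqP b00].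
move: h0; rewrite b00 mulr0 => h0.
have := sqr_ge0 x0; have := sqr_ge0 y0; lra.
Qed.

(** Since cosh (2 d) = 2 (cosh d)^2 - 1, the hypotheses make M the midpoint of P and Q. The inverse
    height is a linear coordinate of the hyperboloid model, so P + Q = 2 c M can be read on it. *)
Lemma cosh3_midpoint P Q M (c : R) : 0 < P.2 -> 0 < Q.2 -> 0 < M.2 ->
  cosh3 P M = c -> cosh3 Q M = c -> cosh3 P Q = 2 * c ^+ 2 - 1 ->
  P.2^-1 + Q.2^-1 = 2 * c / M.2.
Proof.
case: P Q M => [[x y] t] [[x' y'] t'] [[x0 y0] t0] /= tp tp' tp0.
rewrite /cosh3 !normc_sq /= => e e' f.
apply: (@lorentz_midpoint _ (x / t) (y / t) ((x ^+ 2 + y ^+ 2 + t ^+ 2) / t)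
  _ (x' / t') (y' / t') ((x' ^+ 2 + y' ^+ 2 + t' ^+ 2) / t')
  _ (x0 / t0) (y0 / t0) ((x0 ^+ 2 + y0 ^+ 2 + t0 ^+ 2) / t0)).
- by field; rewrite gt_eqF.
- by field; rewrite gt_eqF.
- by field; rewrite gt_eqF.
- by rewrite -e; field; rewrite !gt_eqF.
- by rewrite -e'; field; rewrite !gt_eqF.
- by rewrite -f; field; rewrite !gt_eqF.
Qed.

End HyperbolicGeometry.

(** * The half-plane as the vertical plane over the real axis *)

Section HyperbolicPlane.
Variable R : realType.
Implicit Types (g h : 'M[R]_2) (p q : R * R).

Definition cosh2 p q : R :=
  1 + ((p.1 - q.1) ^+ 2 + (p.2 - q.2) ^+ 2) / (2 * p.2 * q.2).

Definition vplane p : R[i] * R := (p.1%:C, p.2).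

Lemma vplane_inj : injective vplane.
Proof. by move=> [x y] [x' y'] [-> ->]. Qed.

Lemma normc_real (x : R) : normc x%:C ^+ 2 = x ^+ 2.
Proof. by rewrite normc_sq /= expr0n addr0. Qed.

Lemma cosh3_vplane p q : cosh3 (vplane p) (vplane q) = cosh2 p q.
Proof. by rewrite /cosh3 /cosh2 /= subr0 sqr_sqrtr ?addr_ge0 ?sqr_ge0 // expr0n addr0. Qed.

Lemma dist3E (p q : H3 R) : dist3 p q = arcosh (cosh3 (val p) (val q)).
Proof. by case: p q => [[z t] ?] [[w u] ?]. Qed.

Lemma dist2E (p q : H2 R) : dist2 p q = arcosh (cosh2 (val p) (val q)).
Proof. by case: p q => [[z t] ?] [[w u] ?]. Qed.

Lemma cosh2_ge1 p q : 0 < p.2 -> 0 < q.2 -> 1 <= cosh2 p q.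
Proof. by move=> p0 q0; rewrite -cosh3_vplane cosh3_ge1. Qed.

Definition toC g : 'M[R[i]]_2 := map_mx (real_complex R) g.

Lemma toCM g h : toC (g * h) = toC g * toC h.
Proof. exact: map_mxM. Qed.

Lemma det_toC g : \det (toC g) = (\det g)%:C.
Proof. exact: det_map_mx. Qed.

Definition mobden2 g p : R := (g 1 0 * p.1 + g 1 1) ^+ 2 + g 1 0 ^+ 2 * p.2 ^+ 2.

Definition mob g p : R * R :=
  (((g 0 0 * p.1 + g 0 1) * (g 1 0 * p.1 + g 1 1) + g 0 0 * g 1 0 * p.2 ^+ 2) / mobden2 g p,
   p.2 / mobden2 g p).

Lemma mobden_toC g p : mobden (toC g) (vplane p) = mobden2 g p.
Proof.
rewrite /mobden !mxE; change ((vplane p).1) with (p.1%:C); change ((vplane p).2) with (p.2).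
by rewrite -realcM -realcD !normc_real.
Qed.

Lemma vplane_mob g p : vplane (mob g p) = poincare (toC g) (vplane p).
Proof.
rewrite poincareE mobden_toC !mxE; congr (_, _).
change ((vplane p).1) with (p.1%:C); change ((vplane p).2) with (p.2).
by rewrite -!realcM -!realcD !conjc_real -!realcM -!realcD -realcV -realcM.
Qed.

Lemma mobden2_gt0 g p : \det g = 1 -> 0 < p.2 -> 0 < mobden2 g p.
Proof. by move=> dg p0; rewrite -mobden_toC mobden_gt0 // det_toC dg. Qed.

Lemma mob_gt0 g p : \det g = 1 -> 0 < p.2 -> 0 < (mob g p).2.
Proof. by move=> dg p0; rewrite divr_gt0 // mobden2_gt0. Qed.

Lemma mobM g h p : \det g = 1 -> \det h = 1 -> 0 < p.2 -> mob (g * h) p = mob g (mob h p).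
Proof.
move=> dg dh p0; apply: vplane_inj; rewrite !vplane_mob toCM poincareM //.
  by rewrite det_toC dg.
by rewrite det_toC dh.
Qed.

Lemma mob1 p : mob 1 p = p.
Proof. by apply: vplane_inj; rewrite vplane_mob /toC map_mx1 poincare1. Qed.

Lemma cosh2_mob g p q : \det g = 1 -> 0 < p.2 -> 0 < q.2 ->
  cosh2 (mob g p) (mob g q) = cosh2 p q.
Proof.
by move=> dg p0 q0; rewrite -!cosh3_vplane !vplane_mob cosh3_poincare // det_toC dg.
Qed.

End HyperbolicPlane.

(** * Gaussian integers and the Picard group *)

Section Gaussian.
Variable R : realType.
Implicit Types (g h m : 'M[R[i]]_2) (p q : R[i] * R) (z w : R[i]).

Definition gint z : bool :=
  (complex.Re z \is a Num.int) && (complex.Im z \is a Num.int).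

Lemma gintD z w : gint z -> gint w -> gint (z + w).
Proof.
by case: z w => [a b] [c d] /andP[/= ha hb] /andP[/= hc hd]; apply/andP; split => /=; exact: rpredD.
Qed.

Lemma gintN z : gint z -> gint (- z).
Proof. by case: z => [a b] /andP[/= ha hb]; apply/andP; split => /=; rewrite rpredN. Qed.

Lemma gintM z w : gint z -> gint w -> gint (z * w).
Proof.
case: z w => [a b] [c d] /andP[/= ha hb] /andP[/= hc hd].
by apply/andP; split; [apply: rpredB | apply: rpredD]; exact: rpredM.
Qed.

Lemma gint0 : gint 0. Proof. by rewrite /gint /= rpred0. Qed.
Lemma gint1 : gint 1. Proof. by rewrite /gint /= rpred1 rpred0. Qed.

Lemma gint_nat n : gint n%:R.
Proof. by elim: n => [|n ih]; rewrite ?gint0 // mulrS gintD // gint1. Qed.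

Lemma int_sq_ge1 (x : R) : x \is a Num.int -> x != 0 -> 1 <= x ^+ 2.
Proof. by move=> xi x0; rewrite -intr_normK // expr_ge1 // norm_intr_ge1. Qed.

Lemma gint_norm_ge1 z : gint z -> z != 0 -> 1 <= normc z ^+ 2.
Proof.
rewrite normc_sq; case: z => a b /andP[/= ha hb]; rewrite eq_complex /= negb_and.
case/orP => /int_sq_ge1 h1.
  by rewrite ler_wpDr ?sqr_ge0 // h1.
by rewrite ler_wpDl ?sqr_ge0 // h1.
Qed.

Definition gmx m : Prop := forall i j, gint (m i j).

Lemma gmxD g h : gmx g -> gmx h -> gmx (g + h).
Proof. by move=> hg hh i j; rewrite mxE gintD. Qed.

Lemma gmxN g : gmx g -> gmx (- g).
Proof. by move=> hg i j; rewrite mxE gintN. Qed.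

Lemma gmxM g h : gmx g -> gmx h -> gmx (g * h).
Proof. by move=> hg hh i j; rewrite mulmx2E gintD // gintM. Qed.

Lemma gmx_mx2 a b c d : gint a -> gint b -> gint c -> gint d -> gmx (mx2 a b c d).
Proof. by move=> *; move=> i j; rewrite mxE; do 2 case: ifP. Qed.

Lemma gmx1 : gmx 1.
Proof. by rewrite mx2_1; apply: gmx_mx2; rewrite ?gint0 ?gint1. Qed.

Definition Gamma1 : set 'M[R[i]]_2 := [set g | \det g = 1 /\ gmx g].

Lemma gmx_adj2 g : gmx g -> gmx (adj2 g).
Proof. by move=> hg; apply: gmx_mx2; rewrite ?gintN. Qed.

Lemma Gamma1_1 : Gamma1 1. Proof. by split; [rewrite det1 | exact: gmx1]. Qed.

Lemma Gamma1M g h : Gamma1 g -> Gamma1 h -> Gamma1 (g * h).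
Proof.
by case=> dg hg [dh hh]; split; [rewrite -mulmxE det_mulmx dg dh mulr1 | exact: gmxM].
Qed.

Lemma det_adj2 (S : comPzRingType) (A : 'M[S]_2) : \det (adj2 A) = \det A.
Proof. by rewrite !det2E /adj2 !mx2E; ring. Qed.

Lemma Gamma1V g : Gamma1 g -> Gamma1 g^-1.
Proof.
by case=> dg hg; rewrite invr_adj2 //; split; [rewrite det_adj2 | exact: gmx_adj2].
Qed.

(** The sign is a real [e] with [e ^+ 2 = 1], so that products simply multiply signs; both signs are
    allowed because [psl_subgroup] asks for the full preimage in SL_2. *)
Definition Gam (N : nat) : set 'M[R[i]]_2 :=
  [set g | \det g = 1 /\ exists (e : R) m, [/\ e ^+ 2 = 1, gmx m & g = e%:C%:A + N%:R *: m]].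

End Gaussian.

(** * Congruence subgroups of the Picard group *)

Section Congruence.
Variable R : realType.
Implicit Types (g h m : 'M[R[i]]_2) (p q : R[i] * R) (z w : R[i]).

Lemma GamP N g : Gam N g -> \det g = 1 /\ exists (e : R) (a b c d : R[i]),
  [/\ e = 1 \/ e = -1, [/\ gint a, gint b, gint c & gint d]
    & g = mx2 (e%:C + N%:R * a) (N%:R * b) (N%:R * c) (e%:C + N%:R * d)].
Proof.
move=> [dg [e [m [e1 hm gE]]]]; split=> //.
exists e, (m 0 0), (m 0 1), (m 1 0), (m 1 1); split=> //.
  by move/eqP: e1; rewrite sqrf_eq1 => /orP[] /eqP; [left|right].
by rewrite gE; apply: matrix2P; rewrite !mxE /= ?mulr1 ?mulr0 ?add0r.
Qed.

Lemma normc_add_sq z w : normc (z + w) ^+ 2 <= 2 * (normc z ^+ 2 + normc w ^+ 2).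
Proof.
rewrite !normc_sq; case: z w => [a b] [c d] /=.
have := sqr_ge0 (a - c); have := sqr_ge0 (b - d); nra.
Qed.

Lemma normc_natM (N : nat) z : normc (N%:R * z) ^+ 2 = N%:R ^+ 2 * normc z ^+ 2.
Proof.
have -> : N%:R = (N%:R)%:C :> R[i] by rewrite rmorph_nat.
by rewrite normcM exprMn normc_real.
Qed.

(** Here [M] is N^2 and x + i y is det m: among the numbers 2 - M (x + i y) with x + i y a nonzero
    Gaussian integer, the modulus is least at x + i y = 1. *)
Lemma gint_trace_bound (M x y : R) : x \is a Num.int -> y \is a Num.int ->
  (x != 0) || (y != 0) -> 4 <= M -> (M - 2) ^+ 2 <= (2 - M * x) ^+ 2 + (M * y) ^+ 2.
Proof.
move=> hx hy xy0 M4.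
have [y0|y0] := eqVneq y 0; last first.
  have y1 := int_sq_ge1 hy y0.
  have : M ^+ 2 <= (M * y) ^+ 2 by rewrite exprMn ler_peMr // sqr_ge0.
  have := sqr_ge0 (2 - M * x); nra.
rewrite y0 mulr0 expr0n addr0.
have x0 : x != 0 by move: xy0; rewrite y0 eqxx orbF.
have x1 : 1 <= `|x| by exact: norm_intr_ge1.
rewrite -[leRHS]sqrrN opprB; move: x1; rewrite ler_normr => /orP[x1|x1].
  have : M - 2 <= M * x - 2 by rewrite lerD2r ler_peMr //; lra.
  rewrite -ler_sqr // ?nnegrE; nra.
rewrite -[leRHS]sqrrN opprB.
have : M - 2 <= 2 - M * x.
  have : M <= M * - x by rewrite ler_peMr //; lra.
  lra.
rewrite -ler_sqr // ?nnegrE; nra.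
Qed.

(* With m = [[a, b], [c, d]] and det (e + N m) = 1, the trace of e + N m is e (2 - N^2 det m). *)
Lemma gam_trace N (e : R) a b c d : (3 <= N)%N -> e = 1 \/ e = -1 ->
  gint a -> gint b -> gint c -> gint d ->
  (e%:C + N%:R * a) * (e%:C + N%:R * d) - N%:R * b * (N%:R * c) = 1 ->
  (a + d = 0 /\ a * d - b * c = 0) \/
  (N%:R ^+ 2 - 2) ^+ 2 <= normc ((e%:C + N%:R * a) + (e%:C + N%:R * d)) ^+ 2.
Proof.
move=> N3 he ha hb hc hd dg.
have n3 : 3 <= N%:R :> R by rewrite (ler_nat _ 3).
have ee : e%:C ^+ 2 = 1 :> R[i] by rewrite -realcX; case: he => ->; rewrite ?sqrrN expr1n.
(* [dl] is det m. The determinant equation gives e tr m = - N det m, so the trace of g is congruent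
   to 2 e modulo N^2 and not only modulo N. *)
pose dl := a * d - b * c.
have n0 : N%:R != 0 :> R[i] by rewrite pnatr_eq0 -lt0n (leq_trans _ N3).
have tE : e%:C * (a + d) = - (N%:R * dl).
  apply: (mulfI n0); apply/eqP; rewrite -subr_eq0; apply/eqP.
  transitivity ((e%:C + N%:R * a) * (e%:C + N%:R * d) - N%:R * b * (N%:R * c) - e%:C ^+ 2).
    by rewrite /dl; ring.
  by rewrite dg ee subrr.
have tE' : (e%:C + N%:R * a) + (e%:C + N%:R * d) = e%:C * (2 - N%:R ^+ 2 * dl).
  rewrite mulrBr -[N%:R ^+ 2 * dl]opprK -[- (_ * dl)](_ : N%:R * - (N%:R * dl) = _); last by ring.
  by rewrite -tE; transitivity (2 * e%:C + N%:R * (e%:C ^+ 2 * (a + d))); [rewrite ee|]; ring.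
have gdl : gint dl by rewrite gintD ?gintN ?gintM.
have normE : normc (e%:C * (2 - N%:R ^+ 2 * dl)) ^+ 2 = normc (2 - N%:R ^+ 2 * dl) ^+ 2.
  rewrite normcM exprMn normc_real.
  by have -> : e ^+ 2 = 1; [case: he => ->; rewrite ?sqrrN expr1n | rewrite mul1r].
have [dl0|dl0] := eqVneq dl 0; [left|right].
  split=> //; apply: (@mulfI _ e%:C); last by rewrite tE dl0 !mulr0 oppr0.
  by apply/eqP => e0; move: ee; rewrite e0 expr0n /= => /eqP; rewrite eq_sym oner_eq0.
rewrite tE' normE.
have N9 : 9 <= N%:R ^+ 2 :> R by nra.
have key : (N%:R ^+ 2 - 2) ^+ 2 <= normc (2 - N%:R ^+ 2 * dl) ^+ 2.
  have -> : 2 - N%:R ^+ 2 * dl = (2 : R)%:C - ((N%:R : R) ^+ 2)%:C * dl.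
    by rewrite realcX !rmorph_nat.
  move: dl0 gdl; rewrite normc_sq; case: (dl) => x y; rewrite eq_complex negb_and => dl0 /andP[/= hx hy].
  have : 4 <= N%:R ^+ 2 :> R by lra.
  move: (N%:R ^+ 2 : R) => M M4.
  rewrite /= !mul0r subr0 addr0 add0r; rewrite ?sub0r ?sqrrN.
  exact: gint_trace_bound.
exact: key.
Qed.

(* If the trace is small then g = e + N m with m nilpotent, and the displacement is bounded below by
   its entry c, or by its entry b if c = 0. *)
Lemma gam_displacement N g p (s : R) : (3 <= N)%N -> Gam N g -> g != 1 -> g != -1 ->
  0 < p.2 -> 0 <= s -> s <= 1 -> s <= p.2 ^+ 2 -> s * p.2 ^+ 2 <= 1 ->
  1 + N%:R ^+ 2 / 2 * s <= cosh3 p (poincare g p).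
Proof.
move=> N3 /GamP[dg [e [a [b [c [d [he [ha hb hc hd] gE]]]]]]] g1 gN1 p0 s0 s1 s2 s3.
have n3 : 3 <= N%:R :> R by rewrite (ler_nat _ 3).
rewrite cosh3_displacement //.
move: dg; rewrite gE det_mx2 !mx2E => dg.
case: p p0 s2 s3 => z t /= t0 s2 s3.
(* The diagonal entries of the conjugated matrix still add up to the trace of g, so half of |tr g|^2
   bounds their squared moduli from below. *)
set h11 := (X in normc X ^+ 2 + _ + _ + _); set h22 := (X in _ + normc X ^+ 2 + _ + _).
have tr : h11 + h22 = (e%:C + N%:R * a) + (e%:C + N%:R * d) by rewrite /h11 /h22; ring.
have := normc_add_sq h11 h22; rewrite {}tr.
move: h11 h22 => h11 h22.
set n21 := normc (N%:R * c * t%:C); set n12 := normc (_ / _).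
have n21_0 := sqr_ge0 n21; have n12_0 := sqr_ge0 n12.
case: (gam_trace N3 he ha hb hc hd dg) => [[ad0 dl0]|key].
  have da : d = - a by apply/eqP; rewrite -addr_eq0 addrC ad0.
  rewrite da mulrN addrACA subrr addr0.
  have -> : normc (e%:C + e%:C) ^+ 2 = 4 :> R.
    by rewrite -realcD normc_real; case: he => ->; ring.
  move=> trE.
  (* The trace is 2 e, so the diagonal already yields the term 1 and one off-diagonal entry must
     yield the rest. It is N c t, of modulus at least N t, or, when c = 0, it is N b / t with b
     nonzero, of modulus at least N / t: hence the two conditions relating [s] to the height. *)
  suff : N%:R ^+ 2 * s <= n21 ^+ 2 \/ N%:R ^+ 2 * s <= n12 ^+ 2 by case => h; lra.
  have [c0|c0] := eqVneq c 0; [right|left]; last first.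
    rewrite /n21 normcM exprMn normc_real normc_natM -[leRHS]mulrA ler_wpM2l ?sqr_ge0 //.
    by rewrite (le_trans s2) // ler_peMl ?sqr_ge0 // gint_norm_ge1.
  have a0 : a = 0.
    by move: dl0; rewrite c0 mulr0 subr0 da mulrN => /eqP; rewrite oppr_eq0 mulf_eq0 orbb => /eqP.
  have b0 : b != 0.
    apply/eqP => b0; move: gE; rewrite b0 c0 da a0 oppr0 !mulr0 addr0 => gE.
    case: he => eE; move: g1 gN1; rewrite gE eE mx2_1.
      by rewrite eqxx.
    by rewrite mx2_N !oppr0 rmorphN eqxx.
  rewrite /n12 c0 da a0 oppr0 !mulr0 addr0 !mul0r add0r.
  rewrite (mulrC z) addrAC subrr add0r -realcV normcM exprMn normc_natM normc_real.
  rewrite -[leRHS]mulrA ler_wpM2l ?sqr_ge0 // exprVn ler_pdivlMr ?exprn_gt0 //.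
  by rewrite (le_trans s3) // gint_norm_ge1.
(* The diagonal suffices when the trace is large: (M - 2)^2 / 4 >= 1 + M / 2 as soon as M >= 6, with
   M = N^2. *)
have N9 : 9 <= N%:R ^+ 2 :> R by nra.
move=> trE; have : N%:R ^+ 2 / 2 * s <= N%:R ^+ 2 / 2 by rewrite ler_piMr // divr_ge0 ?sqr_ge0.
move: (N%:R ^+ 2 : R) N9 key trE => M M9 key trE hs.
have := sqr_ge0 (M - 9); lra.
Qed.

End Congruence.

Section Congruence2.
Variable R : realType.
Implicit Types (g h m : 'M[R[i]]_2) (p q : R[i] * R) (z w : R[i]).

Lemma Gam_intro N g (e : R) m : \det g = 1 -> e ^+ 2 = 1 -> gmx m ->
  g = e%:C%:A + N%:R *: m -> Gam N g.
Proof. by move=> dg e1 hm gE; split=> //; exists e, m. Qed.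

Lemma gmx_scale z m : gint z -> gmx m -> gmx (z *: m).
Proof. by move=> hz hm i j; rewrite mxE gintM. Qed.

Lemma gmx_real_scale (e : R) m : e ^+ 2 = 1 -> gmx m -> gmx (e%:C *: m).
Proof.
move=> e1 hm; apply: gmx_scale => //; move/eqP: e1; rewrite sqrf_eq1.
by case/orP => /eqP ->; rewrite ?rmorphN ?gintN // gint1.
Qed.

Lemma Gam_gmx N g : Gam N g -> gmx g.
Proof.
move=> [_ [e [m [e1 hm ->]]]]; apply: gmxD; last by apply: gmx_scale => //; exact: gint_nat.
by apply: gmx_real_scale => //; exact: gmx1.
Qed.

Lemma Gam_Gamma1 N g : Gam N g -> Gamma1 g.
Proof. by move=> gN; split; [case: gN | exact: Gam_gmx gN]. Qed.

Lemma det_mulr2 (S : comPzRingType) (A B : 'M[S]_2) : \det (A * B) = \det A * \det B.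
Proof. by rewrite -det_mulmx mulmxE. Qed.

Lemma Gam1 N : Gam N (1 : 'M[R[i]]_2).
Proof.
apply: (@Gam_intro _ _ 1 0); rewrite ?det1 ?expr1n // ?scaler0 ?addr0 ?scale1r //.
by move=> i j; rewrite mxE gint0.
Qed.

Lemma GamN N g : Gam N g -> Gam N (- g).
Proof.
move=> [dg [e [m [e1 hm gE]]]]; apply: (@Gam_intro _ _ (- e) (- m)).
- by rewrite det2E !mxE !mulrNN -det2E.
- by rewrite sqrrN.
- exact: gmxN.
- by rewrite gE opprD rmorphN scaleNr scalerN.
Qed.

Lemma GamM N g h : Gam N g -> Gam N h -> Gam N (g * h).
Proof.
move=> [dg [e [m [e1 hm gE]]]] [dh [f [n [f1 hn hE]]]].
apply: (@Gam_intro _ _ (e * f) (e%:C *: n + f%:C *: m + N%:R *: (m * n))).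
- by rewrite det_mulr2 dg dh mulr1.
- by rewrite exprMn e1 f1 mulr1.
- apply: gmxD; first by apply: gmxD; exact: gmx_real_scale.
  by apply: gmx_scale; [exact: gint_nat | exact: gmxM].
rewrite gE hE mulrDl !mulrDr -!scalerAl !mul1r -!scalerAr !mulr1 realcM !scalerA !scalerDr !scalerA.
by rewrite !addrA (mulrC N%:R e%:C) (mulrC N%:R f%:C) (mulrC f%:C).
Qed.

Lemma GamV N g : Gam N g -> Gam N g^-1.
Proof.
move=> [dg [e [m [e1 hm gE]]]]; rewrite invr_adj2 //.
apply: (@Gam_intro _ _ e (adj2 m)); rewrite ?det_adj2 //; first exact: gmx_adj2.
rewrite gE; apply: matrix2P; rewrite !mxE /= ?mulr0 ?add0r ?mulr1 ?mulrN //.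
Qed.

Lemma Gam_conj N g h : Gam N g -> Gamma1 h -> Gam N (h * g * h^-1).
Proof.
move=> [dg [e [m [e1 hm gE]]]] [dh hh].
have uh : h \is a GRing.unit by rewrite unitmxE dh unitr1.
apply: (@Gam_intro _ _ e (h * m * h^-1)) => //.
- by rewrite !det_mulr2 dg mulr1 -det_mulr2 divrr // det1.
- by apply: gmxM; [exact: gmxM | rewrite invr_adj2 //; exact: gmx_adj2].
- by rewrite gE mulrDr mulrDl -scalerAr mulr1 -scalerAl divrr // -scalerAr -scalerAl.
Qed.

Lemma psl_subgroup_Gam N : psl_subgroup (@Gam R N).
Proof.
split; [by move=> g [] | exact/GamN/Gam1 | exact: GamM | exact: GamV].
Qed.

Lemma discrete_Gamma1 : discrete_subgroup (@Gamma1 R).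
Proof.
exists 1 => // g [dg hg] small; apply/matrixP => i j.
apply/eqP; rewrite -subr_eq0; apply/negPn/negP => ne.
have := gint_norm_ge1 (gintD (hg i j) (gintN (gmx1 R i j))) ne.
rewrite leNgt => /negP; apply; rewrite -subr_gt0.
have := small i j; set x := normc _.
have : 0 <= x by rewrite /x; case: (_ - _) => a b /=; exact: sqrtr_ge0.
move=> x0 x1; rewrite subr_gt0 exprn_ilt1 //.
Qed.

Lemma discrete_Gam N : discrete_subgroup (@Gam R N).
Proof.
by have [e e0 h] := discrete_Gamma1; exists e => // g /Gam_Gamma1; exact: h.
Qed.

End Congruence2.

(** * Torsion-freeness *)

Section TorsionFree.
Variable R : realType.
Implicit Types (g h m : 'M[R[i]]_2) (p q : R[i] * R) (z w : R[i]).

Lemma mxtrace_sq (S : comPzRingType) (A : 'M[S]_2) : \tr (A * A) = \tr A ^+ 2 - 2 * \det A.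
Proof. by rewrite !mxtrace2 !mulmx2E det2E; ring. Qed.

Lemma det_expr (S : comPzRingType) (A : 'M[S]_2) n : \det A = 1 -> \det (A ^+ n) = 1.
Proof. by move=> dA; elim: n => [|n ih]; rewrite ?expr0 ?det1 // exprS det_mulr2 dA ih mulr1. Qed.

Lemma normc_ge0 z : 0 <= normc z.
Proof. by case: z => a b /=; exact: sqrtr_ge0. Qed.

(* tr (g ^ 2) = (tr g) ^ 2 - 2, so the traces of the iterated squares of g grow. *)
Lemma expr_neq1 g n : \det g = 1 -> 3 <= normc (\tr g) -> (0 < n)%N -> g ^+ n <> 1.
Proof.
move=> dg trg n0 gn.
pose T k := normc (\tr (g ^+ (2 ^ k))).
have T3 k : 3 + k%:R <= T k.
  elim: k => [|k ih]; first by rewrite /T expn0 expr1 addr0.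
  have -> : T k.+1 = normc (\tr (g ^+ (2 ^ k)) ^+ 2 - 2).
    by rewrite /T expnS mul2n -addnn exprD mxtrace_sq det_expr // mulr1.
  have := le_normcD (\tr (g ^+ (2 ^ k)) ^+ 2 - 2) 2; rewrite subrK expr2 normcM.
  have -> : normc 2 = 2 :> R.
    by rewrite -[2]/((1 + 1) : R[i]) /= addr0 expr0n addr0 sqrtr_sqr ger0_norm.
  rewrite -/(T k) => h; have k0 : 0 <= k%:R :> R by exact: ler0n.
  by rewrite -natr1; nra.
pose B := \sum_(j < n) normc (\tr (g ^+ j)).
(* The powers of g are periodic of period [n], so one period bounds all traces. *)
have TB k : T k <= B.
  have e : g ^+ (2 ^ k) = g ^+ ((2 ^ k) %% n).
    by rewrite {1}(divn_eq (2 ^ k) n) exprD mulnC exprM gn expr1n mul1r.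
  rewrite /T e /B (bigD1 (Ordinal (ltn_pmod (2 ^ k) n0))) //= lerDl.
  by apply: sumr_ge0 => j _; exact: normc_ge0.
have B0 : 0 <= B by apply: sumr_ge0 => j _; exact: normc_ge0.
have := archi_boundP B0; set k := Num.bound B => kB.
have := T3 k; have := TB k; lra.
Qed.

(** A trace of modulus at least N^2 - 2 >= 7 excludes torsion by [expr_neq1], used with exponent 2 n
    to absorb the sign. Otherwise g = e (1 + M) with M^2 = 0, and g^n = e^n (1 + n M) is scalar only
    if M has no off-diagonal entry; nilpotency then kills the diagonal too. *)
Lemma psl_torsion_free_Gam N : (3 <= N)%N -> psl_torsion_free (@Gam R N).
Proof.
move=> N3 g n gN n0 gn.
have [dg [e [a [b [c [d [he [ha hb hc hd] gE]]]]]]] := GamP gN.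
have n3 : 3 <= N%:R :> R by rewrite (ler_nat _ 3).
have dg' := dg; rewrite gE det_mx2 in dg'.
case: (gam_trace N3 he ha hb hc hd dg') => [[ad0 dl0]|key]; last first.
  exfalso; apply: (@expr_neq1 g (2 * n)) => //; last 1 first.
  - by rewrite mulnC exprM; case: gn => ->; rewrite ?sqrrN expr1n.
  - rewrite gE mxtrace2 !mx2E; move: key; set x := normc _ => key.
    have x0 : 0 <= x by exact: normc_ge0.
    rewrite -ler_sqr ?nnegrE //; apply: le_trans key.
    have : 9 <= N%:R ^+ 2 :> R by nra.
    by move: (N%:R ^+ 2 : R) => K K9; nra.
  - by rewrite muln_gt0.
pose M := N%:R *: mx2 (e%:C * a) (e%:C * b) (e%:C * c) (e%:C * d).
have ee : e%:C ^+ 2 = 1 :> R[i] by rewrite -realcX; case: he => ->; rewrite ?sqrrN expr1n.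
have da : d = - a by apply/eqP; rewrite -addr_eq0 addrC ad0.
have aabc : a * a + b * c = 0.
  by move: dl0; rewrite da mulrN -opprD => /eqP; rewrite oppr_eq0 => /eqP.
have M2 : M * M = 0.
  rewrite /M -scalerAl -scalerAr mul_mx2 da; apply/eqP; rewrite !scaler_eq0; apply/orP; right; apply/orP; right.
  apply/eqP; apply: matrix2P; rewrite !mxE /=.
  - by transitivity (e%:C ^+ 2 * (a * a + b * c)); [ring | rewrite aabc mulr0].
  - by ring.
  - by ring.
  - by transitivity (e%:C ^+ 2 * (a * a + b * c)); [ring | rewrite aabc mulr0].
have gM : g = e%:C *: (1 + M).
  rewrite gE /M; apply: matrix2P; rewrite !mxE /= ?add0r ?mulrDr ?mulr1 (mulrCA e%:C) (mulrA e%:C) -expr2 ee mul1r //.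
have powM k : (1 + M) ^+ k = 1 + k%:R *: M.
  elim: k => [|k ih]; first by rewrite expr0 scale0r addr0.
  by rewrite exprS ih mulrDl mul1r mulrDr mulr1 -scalerAr M2 scaler0 addr0 -addrA -{2}[M]scale1r -scalerDl natr1.
have nM : exists f : R, (f = 1 \/ f = -1) /\ n%:R *: M = (f - 1)%:C%:A.
  have [f [hf fE]] : exists f : R, (f = 1 \/ f = -1) /\ g ^+ n = f%:C%:A.
    case: gn => ->; [exists 1 | exists (-1)]; split; rewrite ?scale1r //; [by left|by right|].
    by rewrite rmorphN scaleN1r.
  exists (e ^+ n * f); split.
    have : (e ^+ n = 1 \/ e ^+ n = -1).
      case: he => ->; first by rewrite expr1n; left.
      by rewrite -signr_odd; case: (odd n); rewrite ?expr0 ?expr1; [right|left].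
    by case: hf => -> [] ->; rewrite ?mulr1 ?mulrN1 ?opprK; [left|right|right|left].
  have : (e ^+ n)%:C *: g ^+ n = (e ^+ n)%:C *: f%:C%:A by rewrite fE.
  have h : (e ^+ n)%:C * e%:C ^+ n = 1 by rewrite realcX -exprMn -expr2 ee expr1n.
  rewrite gM exprZn !scalerA h scale1r powM -realcM.
  have -> : (e ^+ n * f - 1)%:C%:A = (e ^+ n * f)%:C%:A - 1 :> 'M[R[i]]_2.
    by rewrite rmorphB scalerBl scale1r.
  by move=> hh; rewrite -hh addrC addKr /M scalerA.
have [f [_ fE]] := nM.
have nN0 : n%:R * N%:R != 0 :> R[i].
  by rewrite mulf_neq0 // pnatr_eq0 -lt0n // (leq_trans _ N3).
have e0 : e%:C != 0 :> R[i].
  by apply/eqP => e0; move: ee; rewrite e0 expr0n /= => /eqP; rewrite eq_sym oner_eq0.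
have off x : n%:R * (N%:R * (e%:C * x)) = 0 -> x = 0.
  by move/eqP; rewrite mulrA mulf_eq0 (negbTE nN0) mulf_eq0 (negbTE e0) => /eqP.
have b0 : b = 0.
  by apply: off; have /matrixP/(_ 0 1) := fE; rewrite !mxE /= mulr0.
have c0 : c = 0.
  by apply: off; have /matrixP/(_ 1 0) := fE; rewrite !mxE /= mulr0.
have a0 : a = 0.
  by move: aabc; rewrite b0 mul0r addr0 => /eqP; rewrite mulf_eq0 orbb => /eqP.
move: gE; rewrite da a0 b0 c0 oppr0 !mulr0 addr0 => ->.
by case: he => ->; [left|right]; rewrite mx2_1 // mx2_N oppr0 rmorphN.
Qed.

End TorsionFree.

(** Chooses one point of [P] in each fibre that meets it. With [f] the reduction modulo N, these are
    coset representatives. *)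
Lemma finite_reps (T : choiceType) (I : finType) (P : T -> Prop) (f : T -> I) :
  exists s : seq T, (forall y, y \in s -> P y) /\
    forall x, P x -> exists2 y, y \in s & f y = f x.
Proof.
pose r i := if pselect (exists x, P x /\ f x = i) is left e then Some (projT1 (cid e)) else None.
exists (pmap r (enum I)); split=> [y|x Px].
  rewrite mem_pmap => /mapP[i _]; rewrite /r; case: pselect => // e [->].
  by case: (projT2 (cid e)).
have : r (f x) \in [seq r i | i <- enum I] by apply: map_f; rewrite mem_enum.
rewrite /r; case: pselect => [e|]; last by case; exists x.
by move=> h; exists (projT1 (cid e)); [rewrite mem_pmap | case: (projT2 (cid e))].
Qed.

(** * Reduction modulo N and finite index *)

Section Residues.
Variable R : realType.
Implicit Types (g h m : 'M[R[i]]_2) (p q : R[i] * R) (z w : R[i]).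
Variable N : nat.
Hypothesis N0 : (0 < N)%N.

Definition res (x : R) : 'I_N.-1.+1 := inord `|(Num.floor x %% N%:Z)%Z|%N.

Lemma res_eq (x y : R) : x \is a Num.int -> y \is a Num.int -> res x = res y ->
  exists2 k, k \is a Num.int & x = y + N%:R * k.
Proof.
move=> /intrP[a ->] /intrP[b ->] /(congr1 (@nat_of_ord _)).
rewrite /res !intrKfloor !inordK ?prednK //; last 2 first.
- by rewrite -ltz_nat gez0_abs ?modz_ge0 ?ltz_pmod // gt_eqF.
- by rewrite -ltz_nat gez0_abs ?modz_ge0 ?ltz_pmod // gt_eqF.
move=> /(congr1 Posz); rewrite !gez0_abs ?modz_ge0 ?gt_eqF // => e.
exists ((a %/ N)%Z - (b %/ N)%Z)%:~R; first exact: intr_int.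
have E : a = b + N%:Z * ((a %/ N)%Z - (b %/ N)%Z).
  have ea := divz_eq a N; have eb := divz_eq b N; rewrite e in ea.
  move: (a %/ N)%Z (b %/ N)%Z (b %% N)%Z ea eb => qa qb rb -> ->.
  by ring.
by rewrite {1}E rmorphD rmorphM /= -pmulrn.
Qed.

Definition resmx g : {ffun 'I_2 * 'I_2 -> 'I_N.-1.+1 * 'I_N.-1.+1} :=
  [ffun ij => (res (complex.Re (g ij.1 ij.2)), res (complex.Im (g ij.1 ij.2)))].

(** If h = g + N m then g^-1 h = 1 + N g^-1 m, and g^-1 is integral. *)
Lemma resmx_eq g h : Gamma1 g -> Gamma1 h -> resmx g = resmx h -> Gam N (g^-1 * h).
Proof.
move=> [dg hg] [dh hh] /ffunP e.
have ug : g \is a GRing.unit by rewrite unitmxE dg unitr1.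
have H i j : exists2 w, gint w & h i j = g i j + N%:R * w.
  have := e (i, j); rewrite !ffunE /= => -[e1 e2].
  have /andP[g1 g2] := hg i j; have /andP[h1 h2] := hh i j.
  have [k hk kE] := res_eq h1 g1 (esym e1).
  have [l hl lE] := res_eq h2 g2 (esym e2).
  exists (k +i* l); first exact/andP.
  have -> : N%:R = (N%:R)%:C :> R[i] by rewrite rmorph_nat.
  apply/eqP; rewrite eq_complex; move: kE lE; case: (h i j) (g i j) => [? ?] [? ?] /= -> ->.
  by rewrite !mul0r subr0 addr0 !eqxx.
pose m : 'M[R[i]]_2 := \matrix_(i, j) s2val (cid2 (H i j)).
have hE : h = g + N%:R *: m.
  by apply/matrixP => i j; rewrite !mxE; case: (cid2 (H i j)).
have hm : gmx m by move=> i j; rewrite mxE; case: (cid2 (H i j)).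
apply: (@Gam_intro _ _ _ 1 (g^-1 * m)).
- by rewrite invr_adj2 // det_mulr2 det_adj2 dg dh mulr1.
- by rewrite expr1n.
- by apply: gmxM => //; rewrite invr_adj2 //; exact: gmx_adj2.
- by rewrite hE mulrDr mulVr // -scalerAr scale1r.
Qed.

Lemma finite_index_Gam : finite_index (@Gamma1 R) (@Gam R N).
Proof.
split; first by move=> g; exact: Gam_Gamma1.
have [s [hs1 hs2]] := finite_reps (@Gamma1 R) resmx.
exists s; split=> // g gG; have [h hS e] := hs2 _ gG.
by exists h => //; apply: resmx_eq => //; exact: hs1.
Qed.

End Residues.

(** * Reduction theory: lifting points to height at least 1/2 *)

Section Reduction.
Variable R : realType.

Definition nearest (x : R) : R := (Num.floor (x + 2^-1))%:~R.

Lemma nearest_int x : nearest x \is a Num.int.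
Proof. exact: intr_int. Qed.

Lemma nearestP x : (x - nearest x) ^+ 2 <= 4^-1.
Proof.
have := floor_le (x + 2^-1); have := lt_succ_floor (x + 2^-1); rewrite -/(nearest x) rmorphD /= -/(nearest x) => h1 h2.
nra.
Qed.

(** Bernoulli's inequality and the archimedean property. The exponent is what the reduction
    arguments induct on, each step changing the height by a fixed factor. *)
Lemma expn_grow (c t : R) : 1 < c -> 0 < t -> exists n, 1 <= t * c ^+ n.
Proof.
move=> c1 t0; have h n : 1 + n%:R * (c - 1) <= c ^+ n.
  elim: n => [|n ih]; first by rewrite mul0r addr0 expr0.
  rewrite exprS -natr1; have : 0 <= n%:R :> R by exact: ler0n.
  move: (n%:R : R) (c ^+ n) ih => a b ih a0.
  have : c * (1 + a * (c - 1)) <= c * b by rewrite ler_wpM2l //; lra.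
  have : 0 <= a * (c - 1) ^+ 2 by rewrite mulr_ge0 ?sqr_ge0.
  lra.
have c0 : 0 < c - 1 by lra.
have it : 0 <= (t * (c - 1))^-1 by rewrite invr_ge0 mulr_ge0 // ltW.
have := archi_boundP it; set n := Num.bound _ => hn; exists n.
have : 1 < n%:R * (t * (c - 1)) by rewrite -ltr_pdivrMr ?mulr_gt0 // mul1r.
have : t * (1 + n%:R * (c - 1)) <= t * c ^+ n by rewrite ler_wpM2l // ltW.
lra.
Qed.

Lemma poincare_trans (w z : R[i]) (t : R) : poincare (mx2 1 w 0 1) (z, t) = (z + w, t).
Proof.
rewrite poincareE /mobden !mx2E mul0r add0r normc0 normc1 expr1n expr0n mul0r addr0.
by rewrite !divr1 conjc0 conjc1 mul1r mulr1 mulr0 mul0r addr0.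
Qed.

Lemma poincare_inv (z : R[i]) (t : R) : (poincare (mx2 0 (-1) 1 0) (z, t)).2 = t / (normc z ^+ 2 + t ^+ 2).
Proof. by rewrite poincareE /mobden !mx2E mul1r addr0 normc1 expr1n mul1r. Qed.

Lemma Gamma1_trans (w : R[i]) : gint w -> Gamma1 (mx2 1 w 0 1).
Proof.
by move=> hw; split; [rewrite det_mx2; ring | apply: gmx_mx2; rewrite ?gint0 ?gint1].
Qed.

Lemma Gamma1_inv : Gamma1 (mx2 0 (-1) 1 0 : 'M[R[i]]_2).
Proof.
by split; [rewrite det_mx2; ring | apply: gmx_mx2; rewrite ?gintN ?gint0 ?gint1].
Qed.

(* Translating z near 0 and inverting multiplies a height below 1/2 by at least 4/3. *)
Lemma Gamma1_reduction (p : R[i] * R) : 0 < p.2 ->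
  exists2 g, Gamma1 g & 2^-1 <= (poincare g p).2.
Proof.
move=> p0; have c1 : 1 < 4 / 3 :> R by lra.
have [n] := expn_grow c1 p0; elim: n p p0 => [|n ih] p p0 hn.
  exists 1; first exact: Gamma1_1.
  by rewrite poincare1; move: hn; rewrite expr0; lra.
have [h|h] := leP (2^-1) p.2.
  by exists 1; [exact: Gamma1_1 | rewrite poincare1].
case: p p0 hn h => [[x y] t] t0 hn h; rewrite /= in t0 hn h.
pose w := (- nearest x) +i* (- nearest y).
have hw : gint w by rewrite /gint /= !rpredN !nearest_int.
have e : (poincare (mx2 0 (-1) 1 0) (poincare (mx2 1 w 0 1) (x +i* y, t))).2 =
    t / ((x - nearest x) ^+ 2 + (y - nearest y) ^+ 2 + t ^+ 2).
  by rewrite poincare_trans poincare_inv normc_sq.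
have dT := (Gamma1_trans hw).1; have dS := Gamma1_inv.1.
have T0 : 0 < (poincare (mx2 1 w 0 1) (x +i* y, t)).2 by rewrite poincare_gt0.
have S0 := poincare_gt0 dS T0.
have hx := nearestP x; have hy := nearestP y.
have [|g gG gh] := ih _ S0.
  apply: (le_trans hn); rewrite exprS mulrA ler_wpM2r ?exprn_ge0 //.
  rewrite {}e; move: hx hy; move: ((x - nearest x) ^+ 2) (sqr_ge0 (x - nearest x))
    ((y - nearest y) ^+ 2) (sqr_ge0 (y - nearest y)) => a a0 b b0 ha hb.
  (* The three terms of the denominator are at most 1/4 each, whence the factor 4 / 3. *)
  have tt : t ^+ 2 <= 4^-1 by nra.
  have tt0 : 0 < t ^+ 2 by rewrite exprn_gt0.
  rewrite ler_pdivlMr; last lra.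
  have : t * (a + b + t ^+ 2) <= t * (3 / 4) by rewrite ler_wpM2l ?(ltW t0) //; lra.
  by lra.
exists (g * (mx2 0 (-1) 1 0 * mx2 1 w 0 1)).
  by apply: Gamma1M => //; apply: Gamma1M; [exact: Gamma1_inv | exact: Gamma1_trans].
by rewrite !poincareM ?det_mulr2 ?dT ?dS ?mulr1 //; case: gG.
Qed.

End Reduction.

(** * The real points of the congruence group as a surface group *)

Section IntegralReal.
Variable R : realType.
Implicit Types (g h : 'M[R]_2) (p q : R * R).

(** SL_2(Z) seen inside the Picard group, from which the group laws are inherited. *)
Definition SLZ : set 'M[R]_2 := [set g | Gamma1 (toC g)].

Lemma SLZ_det g : SLZ g -> \det g = 1.
Proof. by move=> [dg _]; apply: (@complexI R); rewrite -det_toC. Qed.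

Lemma toC1 : toC (1 : 'M[R]_2) = 1. Proof. exact: map_mx1. Qed.

Lemma toCV g : \det g = 1 -> toC g^-1 = (toC g)^-1.
Proof.
move=> dg; rewrite !invr_adj2 ?det_toC ?dg // .
by apply: matrix2P; rewrite !mxE ?rmorphN.
Qed.

Lemma SLZ1 : SLZ 1. Proof. by rewrite /SLZ /= toC1; exact: Gamma1_1. Qed.
Lemma SLZM g h : SLZ g -> SLZ h -> SLZ (g * h).
Proof. by move=> hg hh; rewrite /SLZ /= toCM; exact: Gamma1M. Qed.
Lemma SLZV g : SLZ g -> SLZ g^-1.
Proof. by move=> hg; rewrite /SLZ /= toCV ?SLZ_det //; exact: Gamma1V. Qed.

Lemma SLZ_mx2 a b c d : a * d - b * c = 1 -> a \is a Num.int -> b \is a Num.int ->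
  c \is a Num.int -> d \is a Num.int -> SLZ (mx2 a b c d).
Proof.
move=> dg ha hb hc hd; split; first by rewrite det_toC det_mx2 dg.
by move=> i j; rewrite !mxE /gint /=; do 2 case: ifP => _; rewrite ?ha ?hb ?hc ?hd rpred0.
Qed.

Lemma mob_trans w p : mob (mx2 1 w 0 1) p = (p.1 + w, p.2).
Proof.
by rewrite /mob /mobden2 !mx2E mul0r add0r expr1n expr0n mul0r addr0 !divr1 mul1r mulr1 mulr0 mul0r addr0.
Qed.

Lemma mob_inv p : mob (mx2 0 (-1) 1 0) p = (- p.1 / (p.1 ^+ 2 + p.2 ^+ 2), p.2 / (p.1 ^+ 2 + p.2 ^+ 2)).
Proof.
by rewrite /mob /mobden2 !mx2E mul1r addr0 expr1n mul1r mul0r add0r mulN1r !mul0r addr0.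
Qed.

(** The induction of [Gamma1_reduction], followed by one integral translation, which recentres the
    abscissa and keeps the height. *)
Lemma SLZ_reduction p : 0 < p.2 -> exists2 g, SLZ g &
  `|(mob g p).1| <= 2^-1 /\ 2^-1 <= (mob g p).2.
Proof.
move=> p0; suff [g gG hg] : exists2 g, SLZ g & 2^-1 <= (mob g p).2.
  have dg := SLZ_det gG.
  have hT : SLZ (mx2 1 (- nearest (mob g p).1) 0 1).
    by apply: SLZ_mx2; rewrite ?rpredN ?nearest_int ?rpred0 ?rpred1 //; ring.
  exists (mx2 1 (- nearest (mob g p).1) 0 1 * g); first exact: SLZM.
  rewrite mobM ?SLZ_det // mob_trans /=; split=> //.
  have := nearestP (mob g p).1; move: (_ - _) => a ha.
  by rewrite -ler_sqr ?nnegrE // real_normK ?num_real //; lra.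
have c1 : 1 < 4 / 3 :> R by lra.
have [n] := expn_grow c1 p0; elim: n p p0 => [|n ih] p p0 hn.
  by exists 1; [exact: SLZ1 | rewrite mob1; move: hn; rewrite expr0; lra].
have [h|h] := leP (2^-1) p.2.
  by exists 1; [exact: SLZ1 | rewrite mob1].
case: p p0 hn h => [x t] t0 hn h; rewrite /= in t0 hn h.
have hT : SLZ (mx2 1 (- nearest x) 0 1).
  by apply: SLZ_mx2; rewrite ?rpredN ?nearest_int ?rpred0 ?rpred1 //; ring.
have hS : SLZ (mx2 0 (-1) 1 0).
  by apply: SLZ_mx2; rewrite ?rpredN ?rpred0 ?rpred1 //; ring.
have dT := SLZ_det hT; have dS := SLZ_det hS.
have e : (mob (mx2 0 (-1) 1 0) (mob (mx2 1 (- nearest x) 0 1) (x, t))).2 =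
    t / ((x - nearest x) ^+ 2 + t ^+ 2) by rewrite mob_trans mob_inv.
have T0 : 0 < (mob (mx2 1 (- nearest x) 0 1) (x, t)).2 by rewrite mob_gt0.
have S0 := mob_gt0 dS T0.
have hx := nearestP x.
have [|g gG gh] := ih _ S0.
  apply: (le_trans hn); rewrite exprS mulrA ler_wpM2r ?exprn_ge0 //.
  rewrite {}e; move: hx; move: ((x - nearest x) ^+ 2) (sqr_ge0 (x - nearest x)) => a a0 ha.
  have tt : t ^+ 2 <= 4^-1 by nra.
  have tt0 : 0 < t ^+ 2 by rewrite exprn_gt0.
  rewrite ler_pdivlMr; last lra.
  have : t * (a + t ^+ 2) <= t * (3 / 4) by rewrite ler_wpM2l ?(ltW t0) //; lra.
  by lra.
exists (g * (mx2 0 (-1) 1 0 * mx2 1 (- nearest x) 0 1)).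
  by apply: SLZM => //; exact: SLZM.
by rewrite !mobM ?det_mulr2 ?dT ?dS ?mulr1 // SLZ_det.
Qed.

(* Meaningful only if det g = 1: insubd returns p when the image leaves the half-plane. *)
Definition mobH g (p : H2 R) : H2 R := insubd p (mob g (val p)).

Lemma val_mobH g (p : H2 R) : \det g = 1 -> val (mobH g p) = mob g (val p).
Proof. by move=> dg; rewrite /mobH val_insubd mob_gt0 //; exact: (valP p). Qed.

Definition vplaneH (p : H2 R) : H3 R := exist _ (vplane (val p)) (valP p).

Definition GamZ N : set (H2 R -> H2 R) := [set mobH g | g in [set g | Gam N (toC g)]].

Lemma cosh2_eq1 p q : 0 < p.2 -> 0 < q.2 -> cosh2 p q = 1 -> p = q.
Proof. by move=> p0 q0 h; apply: vplane_inj; apply: cosh3_eq1; rewrite ?cosh3_vplane. Qed.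

(** The minimum of 1, t^2 and t^-2 is the value of [s] that [gam_displacement] accepts at height
    t. *)
Lemma height_scale (t : R) : 0 < t -> exists s : R, [/\ 0 < s, s <= 1, s <= t ^+ 2 & s * t ^+ 2 <= 1].
Proof.
move=> t0; have u0 : 0 < t ^+ 2 by rewrite exprn_gt0.
move: (t ^+ 2) u0 => u u0; exists (Num.min 1 (Num.min u u^-1)).
rewrite !lt_min ltr01 u0 invr_gt0 u0 !ge_min lexx /= lexx !orbT /=; split=> //.
by rewrite -ler_pdivlMr // mul1r !ge_min lexx !orbT.
Qed.

Lemma surface_group_GamZ N : (3 <= N)%N -> surface_group (GamZ N).
Proof.
move=> N3.
have det1G g : Gam N (toC g) -> \det g = 1 by move=> /Gam_Gamma1; exact: SLZ_det.
have E g (p : H2 R) : Gam N (toC g) -> val (mobH g p) = mob g (val p).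
  by move=> /det1G; exact: val_mobH.
split.
- exists 1; first by rewrite /= toC1; exact: Gam1.
  by apply/funext => p; apply: val_inj; rewrite val_mobH ?det1 // mob1.
- move=> _ _ [g gG <-] [h hG <-]; exists (g * h); first by rewrite /= toCM; exact: GamM.
  apply/funext => p; apply: val_inj; rewrite /= val_mobH ?det_mulr2 ?det1G ?mulr1 //.
  by rewrite mobM ?det1G ?(valP p) // !val_mobH ?det1G.
- move=> _ [g gG <-]; have dg := det1G _ gG.
  have ug : g \is a GRing.unit by rewrite unitmxE dg unitr1.
  have gV : Gam N (toC g^-1) by rewrite toCV //; exact: GamV.
  have dV := det1G _ gV.
  exists (mobH g^-1); split; first by exists g^-1.
    move=> p; apply: val_inj; rewrite !val_mobH // -mobM ?(valP p) // mulVr //; exact: mob1.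
  move=> p; apply: val_inj; rewrite !val_mobH // -mobM ?(valP p) // divrr //; exact: mob1.
- move=> _ [g gG <-] p q; rewrite !dist2E !E // cosh2_mob ?det1G ?(valP p) ?(valP q) //.
move=> p; have p0 := valP p; have [s [s0 s1 s2 s3]] := height_scale p0.
have N0 : 0 < N%:R :> R by rewrite ltr0n (leq_trans _ N3).
(* The displacement bound at the height of [p] gives the radius of discontinuity: within it the
   matrix is 1 or -1, and both act as the identity. *)
pose K : R := 1 + N%:R ^+ 2 / 2 * s.
have K1 : 1 < K by rewrite ltrDl !mulr_gt0 // exprn_gt0.
exists (arcosh K).
  have <- : arcosh 1 = 0 :> R by rewrite /arcosh expr1n subrr sqrtr0 addr0 ln1.
  exact: arcosh_lt.
move=> _ [g gG <-]; rewrite dist2E E // -cosh3_vplane vplane_mob => lt.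
have [g1|g1] := eqVneq (toC g) 1.
  by apply/funext => q; apply: val_inj; rewrite E //; apply: vplane_inj; rewrite vplane_mob g1 poincare1.
have [gN1|gN1] := eqVneq (toC g) (-1).
  by apply/funext => q; apply: val_inj; rewrite E //; apply: vplane_inj; rewrite vplane_mob gN1 poincareN poincare1.
have := @gam_displacement R N (toC g) (vplane (val p)) s N3 gG g1 gN1 p0 (ltW s0) s1 s2 s3.
rewrite -/K => KC; move: lt; rewrite ltNge arcosh_le ?KC ?(ltW K1) //.
by rewrite (le_trans (ltW K1)).
Qed.

Lemma vplaneH_immersion N : totally_geodesic_immersion (GamZ N) (@Gam R N) vplaneH.
Proof.
split; last by move=> p q; rewrite dist3E dist2E cosh3_vplane.
move=> _ p [g gG <-]; exists (toC g) => //=; rewrite val_mobH ?vplane_mob //.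
by apply: SLZ_det; exact: Gam_Gamma1 gG.
Qed.

End IntegralReal.

(** * Totally geodesic planes *)

Section TotallyGeodesic.
Variable R : realType.

Definition H2pt (x y : R) (y0 : 0 < y) : H2 R := exist _ (x, y) y0.
Definition H3pt (z : R[i]) (t : R) (t0 : 0 < t) : H3 R := exist _ (z, t) t0.

Lemma isometry_cosh (F : H2 R -> H3 R) (p q : H2 R) :
  (forall p q, dist3 (F p) (F q) = dist2 p q) ->
  cosh3 (val (F p)) (val (F q)) = cosh2 (val p) (val q).
Proof.
move=> /(_ p q); rewrite dist3E dist2E => /arcosh_inj; apply.
  by apply: cosh3_ge1; [exact: (valP (F p)) | exact: (valP (F q))].
by apply: cosh2_ge1; [exact: (valP p) | exact: (valP q)].
Qed.

(* A geodesic plane leaves every horoball: from a point of height h > 2 one of the two points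
   at distance arcosh (5 / 4) on a geodesic through it has height in [2 h / 5, 4 h / 5]. *)
Lemma plane_bounded_height (F : H2 R -> H3 R) :
  (forall p q, dist3 (F p) (F q) = dist2 p q) ->
  exists g (p : H2 R), [/\ Gamma1 g, 2^-1 <= (poincare g (val (F p))).2 &
    (poincare g (val (F p))).2 <= 2].
Proof.
move=> isoF.
have [g gG g2] := Gamma1_reduction (valP (F (H2pt 0 (@ltr01 R)))).
exists g; have dg := gG.1.
pose h p := (poincare g (val (F p))).2.
have h0 p : 0 < h p by rewrite poincare_gt0 // (valP (F p)).
suff H n p : 2^-1 <= h p -> h p <= 2 * (5 / 4) ^+ n ->
    exists p, 2^-1 <= h p /\ h p <= 2.
  have ih : 0 < 2 / h (H2pt 0 (@ltr01 R)) by rewrite divr_gt0.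
  have c1 : 1 < 5 / 4 :> R by lra.
  have [n hn] := expn_grow c1 ih.
  have [|p [p1 p2]] := H n _ g2; last by exists p.
  by move: hn; rewrite mulrAC ler_pdivlMr ?mul1r.
elim: n p => [|n ih] p p1 p2; first by exists p; move: p2; rewrite expr0 mulr1.
have [hp|hp] := leP (h p) 2; first by exists p.
case: p p1 p2 hp => [[x y] y0] p1 p2 hp; move: (y0) => /= y0'.
(* Doubling and halving the height moves [p] by ln 2 both ways along a vertical geodesic; cosh (ln
   2) = 5 / 4 and cosh (2 ln 2) = 17 / 8 = 2 (5 / 4)^2 - 1. *)
have P0 : 0 < 2 * y by rewrite mulr_gt0.
have Q0 : 0 < y / 2 by rewrite divr_gt0.
pose p := H2pt x y0; pose P := H2pt x P0; pose Q := H2pt x Q0.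
have mid : (h P)^-1 + (h Q)^-1 = 2 * (5 / 4) / h p.
  apply: cosh3_midpoint; rewrite ?h0 //.
  - rewrite cosh3_poincare ?(valP (F _)) // isometry_cosh //= /cosh2 /=.
    by field; rewrite gt_eqF.
  - rewrite cosh3_poincare ?(valP (F _)) // isometry_cosh //= /cosh2 /=.
    by field; rewrite gt_eqF.
  - rewrite cosh3_poincare ?(valP (F _)) // isometry_cosh //= /cosh2 /=.
    by field; rewrite gt_eqF.
(* The larger of the two inverse heights lies between half their sum and their sum. As [h p > 2],
   the new height stays above 4 / 5, and it drops by a factor at least 5 / 4, which lowers [n] by
   one. *)
have step (r : H2 R) : 5 / 4 / h p <= (h r)^-1 -> (h r)^-1 <= 5 / 2 / h p ->
    exists p, 2^-1 <= h p /\ h p <= 2.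
  move=> r1 r2; have hr := h0 r; have hp0 : 0 < h p by exact: h0.
  apply: (ih r).
    have hri : 0 < (h r)^-1 by rewrite invr_gt0.
    rewrite -[leRHS]invrK lef_pV2 ?posrE //.
    by move: r2 hp; rewrite -/p ler_pdivlMr //; move: (h r)^-1 (h p) hri hp0 => u v; nra.
  move: r1; rewrite -[X in _ <= X]mul1r ler_pdivlMr // mulrAC ler_pdivrMr // => r1.
  by move: p2; rewrite exprS -/p; move: ((5 / 4) ^+ n) => u; lra.
have hPi : 0 < (h P)^-1 by rewrite invr_gt0.
have hQi : 0 < (h Q)^-1 by rewrite invr_gt0.
have [PQ|PQ] := leP (h P)^-1 (h Q)^-1; [apply: (step Q)|apply: (step P)]; lra.
Qed.

(** The element k of Gam N that takes F b to F (f b) moves F b by cosh at most [K], while at the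
    height of g F b any element other than +-1 moves points further. So k fixes F b, and F is
    injective. *)
Lemma immersion_injective N L (F : H2 R -> H3 R) g (p b : H2 R) f (K : R) : (3 <= N)%N ->
  totally_geodesic_immersion L (@Gam R N) F -> Gamma1 g ->
  2^-1 <= (poincare g (val (F p))).2 -> (poincare g (val (F p))).2 <= 2 ->
  1 <= K -> K < 1 + N%:R ^+ 2 / 2 * (4 * K) ^- 2 ->
  L f -> cosh2 (val p) (val b) <= K -> cosh2 (val b) (val (f b)) <= K -> f b = b.
Proof.
move=> N3 [orbF isoF] gG h1 h2 K1 KN Lf pb bfb.
have dg := gG.1; have Fb0 := valP (F b); have Fp0 := valP (F p).
have [k kG kE] := orbF _ b Lf.
suff kb : poincare k (val (F b)) = val (F b).
  apply: val_inj; apply: cosh2_eq1; rewrite ?(valP b) ?(valP (f b)) //.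
  by rewrite -(isometry_cosh _ _ isoF) kE kb /cosh3 !subrr normc0 expr0n addr0 mul0r addr0.
have [->|k1] := eqVneq k 1; first by rewrite poincare1.
have [->|kN1] := eqVneq k (-1); first by rewrite poincareN poincare1.
exfalso; pose t := (poincare g (val (F b))).2.
have t0 : 0 < t by exact: poincare_gt0.
have gFp0 := poincare_gt0 dg Fp0.
have cpb : cosh3 (poincare g (val (F p))) (poincare g (val (F b))) <= K.
  by rewrite cosh3_poincare // isometry_cosh.
(* Within cosh [K] of a point with height in [1/2, 2], heights lie in [1 / (4 K), 4 K]; this is why
   [s] is (4 K)^-2 below. *)
have tlow : 1 <= 4 * K * t by have := cosh3_height gFp0 t0 cpb; rewrite -/t; lra.
have thigh : t <= 4 * K.
  have : t <= 2 * K * (poincare g (val (F p))).2.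
    by apply: cosh3_height => //; rewrite cosh3_sym.
  nra.
have ug : g \is a GRing.unit by rewrite unitmxE dg unitr1.
have g'G := Gam_conj kG gG; set k' := g * k * g^-1 in g'G.
have dk := kG.1.
have k'E : k' * g = g * k by rewrite /k' -mulrA mulVr // mulr1.
have K4 : 0 < 4 * K by lra.
have K40 : 0 < (4 * K) ^- 2 by rewrite invr_gt0 exprn_gt0.
have k'1 : k' != 1.
  apply: contraNneq k1 => e; apply/eqP; apply: (mulrI ug).
  by rewrite mulr1 -k'E e mul1r.
have k'N1 : k' != -1.
  apply: contraNneq kN1 => e; apply/eqP; apply: (mulrI ug).
  by rewrite mulrN1 -k'E e mulN1r.
have := @gam_displacement R N k' (poincare g (val (F b))) ((4 * K) ^- 2) N3 g'G k'1 k'N1 t0 (ltW K40).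
rewrite -poincareM ?g'G.1 // k'E poincareM // -kE cosh3_poincare ?(valP (F _)) // isometry_cosh //.
rewrite -/t.
have T : (4 * K) ^- 2 <= 1.
  by rewrite invf_le1 ?exprn_gt0 // exprn_ege1 //; lra.
have T2 : (4 * K) ^- 2 <= t ^+ 2.
  rewrite -[leLHS]mul1r ler_pdivrMr ?exprn_gt0 // -exprMn (mulrC t) exprn_ege1 //.
have T3 : (4 * K) ^- 2 * t ^+ 2 <= 1.
  by rewrite mulrC ler_pdivrMr ?exprn_gt0 // mul1r ler_sqr ?nnegrE // ltW.
by move=> /(_ T T2 T3); lra.
Qed.

(** The translation by N, conjugated so as to act where [p] has been lifted to height h >= 1/2, has
    displacement 1 + N^2 / (2 h^2). Valid at every point, this caps the injectivity radius of the
    whole manifold. *)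
Lemma Gam_move N (p : H3 R) : (0 < N)%N -> exists q : H3 R,
  [/\ q <> p, orbit3 (@Gam R N) p q & cosh3 (val p) (val q) <= 1 + 2 * N%:R ^+ 2].
Proof.
move=> N0; have p0 := valP p; have [g gG gh] := Gamma1_reduction p0.
have dg := gG.1; have ug : g \is a GRing.unit by rewrite unitmxE dg unitr1.
pose T : 'M[R[i]]_2 := mx2 1 N%:R 0 1.
have TG : Gam N T.
  apply: (@Gam_intro _ _ _ 1 (mx2 0 1 0 0)).
  - by rewrite det_mx2; ring.
  - by rewrite expr1n.
  - by apply: gmx_mx2; rewrite ?gint0 ?gint1.
  - by apply: matrix2P; rewrite !mxE /= ?mulr1 ?mulr0 ?addr0 ?add0r.
have kG := Gam_conj TG (Gamma1V gG); rewrite invrK in kG.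
set k := g^-1 * T * g in kG; have dk := kG.1.
have kE : g * k = T * g by rewrite /k !mulrA divrr // mul1r.
have q0 := poincare_gt0 dk p0.
pose q : H3 R := exist _ (poincare k (val p)) q0.
have C : cosh3 (val p) (val q) = 1 + N%:R ^+ 2 / (2 * (poincare g (val p)).2 ^+ 2).
  rewrite -(@cosh3_poincare _ g) // -poincareM // kE poincareM ?TG.1 //.
  case: (poincare g (val p)) => z t; rewrite poincare_trans /cosh3 /= opprD addrA subrr add0r subrr.
  rewrite normcN -[N%:R](rmorph_nat (real_complex R)) normc_real expr0n addr0.
  by rewrite -mulrA -expr2.
have h2 := poincare_gt0 dg p0.
exists q; split.
- move=> e; move: C; rewrite e /cosh3 !subrr normc0 expr0n addr0 mul0r => /addrI /esym/eqP.
  by rewrite gt_eqF // divr_gt0 ?mulr_gt0 ?exprn_gt0 ?ltr0n.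
- by exists k.
rewrite C lerD2l ler_pdivrMr ?mulr_gt0 ?exprn_gt0 //.
have : 4^-1 <= (poincare g (val p)).2 ^+ 2 by nra.
have : 0 <= N%:R ^+ 2 :> R by exact: sqr_ge0.
by move: (N%:R ^+ 2 : R) ((poincare g (val p)).2 ^+ 2) => a b; nra.
Qed.

(** Height 1 allows [s = 1], the best value in [gam_displacement]; this is the point where the
    injectivity radius is bounded below. *)
Lemma Gam_far N (q : H3 R) : (3 <= N)%N -> q <> H3pt 0 (@ltr01 R) ->
  orbit3 (@Gam R N) (H3pt 0 (@ltr01 R)) q ->
  1 + N%:R ^+ 2 / 2 <= cosh3 (val (H3pt 0 (@ltr01 R))) (val q).
Proof.
move=> N3 qp [k kG kE]; rewrite kE -[_ / 2]mulr1.
apply: gam_displacement; rewrite ?ler01 ?lexx //= ?expr1n ?mulr1 //.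
  by apply/eqP => k1; apply: qp; apply: val_inj; rewrite kE k1 poincare1.
by apply/eqP => k1; apply: qp; apply: val_inj; rewrite kE k1 poincareN poincare1.
Qed.

Lemma isometry3_cosh (F : H3 R -> H3 R) (p q : H3 R) :
  (forall p q, dist3 (F p) (F q) = dist3 p q) ->
  cosh3 (val (F p)) (val (F q)) = cosh3 (val p) (val q).
Proof.
move=> /(_ p q); rewrite !dist3E => /arcosh_inj; apply; apply: cosh3_ge1.
- exact: (valP (F p)).
- exact: (valP (F q)).
- exact: (valP p).
- exact: (valP q).
Qed.

Lemma isometric_sym (G G' : set 'M[R[i]]_2) : isometric_manifolds G G' -> isometric_manifolds G' G.
Proof.
move=> [phi [[psi pK Kp] iso orb]]; exists psi; split; first by exists phi.
  by move=> p q; rewrite -iso !Kp.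
by move=> p q; rewrite orb !Kp.
Qed.

(** An isometry would transport to the point (0, 1) at level N' the displacement at most 1 + 2 N^2
    that level N has everywhere, although there it is at least 1 + N'^2 / 2. *)
Lemma Gam_not_isometric N N' : (3 <= N)%N -> (3 * N <= N')%N ->
  ~ isometric_manifolds (@Gam R N) (@Gam R N').
Proof.
move=> N3 NN' [phi [[psi pK Kp] iso orb]].
pose o := H3pt 0 (@ltr01 R).
have N'3 : (3 <= N')%N by apply: leq_trans NN'; rewrite (leq_trans N3) // leq_pmull.
have N0 : (0 < N)%N by exact: leq_trans N3.
have [q [qp oq cq]] := @Gam_move N (psi o) N0.
have := @Gam_far N' (phi q) N'3; rewrite -/o.
have -> : val o = val (phi (psi o)) by rewrite Kp.
rewrite (isometry3_cosh _ _ iso) => /(_ _ _) far.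
have : 1 + N'%:R ^+ 2 / 2 <= cosh3 (val (psi o)) (val q).
  apply: far; first by move=> e; apply: qp; rewrite -e pK.
  by rewrite -[X in orbit3 _ X]Kp; apply/orb.
have n3 : 3 <= N%:R :> R by rewrite (ler_nat _ 3).
have : 3 * N%:R <= N'%:R :> R by rewrite -natrM ler_nat.
by move: (N%:R : R) (N'%:R : R) cq n3 => a b cq n3 ab; nra.
Qed.

End TotallyGeodesic.

(** * Properness of the vertical plane *)

Section Proper.
Variable R : realType.

Lemma seq_bound (T : eqType) (s : seq T) (f : T -> R) : exists M, forall x, x \in s -> f x <= M.
Proof.
elim: s => [|a s [M hM]]; first by exists 0.
exists (Num.max (f a) M) => x; rewrite inE => /predU1P[->|/hM xM]; rewrite le_max ?lexx //.
by rewrite xM orbT.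
Qed.

(* The horoball of height 1 is precisely invariant under the Picard group. *)
Lemma Gamma1_height (g : 'M[R[i]]_2) (p : R[i] * R) : Gamma1 g -> 0 < p.2 ->
  p.2 <= (poincare g p).2 \/ p.2 * (poincare g p).2 <= 1.
Proof.
move=> [dg hg] p0; have D0 := mobden_gt0 dg p0; rewrite poincareE /=.
have [c0|c0] := eqVneq (g 1 0) 0; [left|right].
  rewrite ler_pdivlMr // ler_piMr ?(ltW p0) //.
  move: dg; rewrite det2E c0 mulr0 subr0 => dg.
  rewrite /mobden c0 mul0r add0r normc0 expr0n mul0r addr0.
  have a0 : g 0 0 != 0 by apply: contra_eq_neq dg => ->; rewrite mul0r eq_sym oner_eq0.
  have : normc (g 0 0) ^+ 2 * normc (g 1 1) ^+ 2 = 1 by rewrite -exprMn -normcM dg normc1 expr1n.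
  have := gint_norm_ge1 (hg 0 0) a0; have := sqr_ge0 (normc (g 1 1)).
  by move=> d0 a1 e; rewrite -[leRHS]e ler_peMl.
rewrite mulrA -expr2 ler_pdivrMr // mul1r /mobden.
have := gint_norm_ge1 (hg 1 0) c0; have := sqr_ge0 (normc (g 1 0 * p.1 + g 1 1)).
have : 0 <= p.2 ^+ 2 by exact: sqr_ge0.
by move: (p.2 ^+ 2) (normc (g 1 0) ^+ 2) (normc _ ^+ 2) => a b c; nra.
Qed.

(** Let k in SL_2(Z) move [p] to a point z of the box |x| <= 1/2, y >= 1/2. If the orbit of [p]
    meets the given ball, z cannot be too high, so it stays in a compact set. The class of k modulo
    N is that of one of finitely many c, and c^-1 k, which lies in the group, brings [p] near
    [o2]. *)
Lemma vplane_proper N : (0 < N)%N -> proper_immersion (@GamZ R N) (@Gam R N) (@vplaneH R).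
Proof.
move=> N0 o3 o2 r.
have [s [s1 s2]] := finite_reps (@SLZ R) (fun g => resmx N (toC g)).
pose t0 := (val o3).2; have t0_gt0 : 0 < t0 by exact: (valP o3).
(* The orbit point in the ball has height between t0 / (2 E) and 2 E t0. By [Gamma1_height] z is
   either no higher than it or no higher than its inverse; [Y] is the sum of the two bounds. *)
pose E := expR r; pose Y := 2 * E / t0 + 2 * E * t0.
(* Bounds the cosh of the distance from k o2 to every point with |x| <= 1/2 and 1/2 <= y <= Y; the
   lower bound on y turns the denominator 2 v y into v. *)
pose B (k : 'M[R]_2) := let q := mob k (val o2) in
  1 + ((`|q.1| + 2^-1) ^+ 2 + (q.2 + Y) ^+ 2) / q.2.
have [M hM] := seq_bound s B.
exists (arcosh M) => p [q [g gG qE]]; rewrite dist3E => /arcosh_le_exp -/(_ (cosh3_ge1 (valP o3) (valP q))) oq.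
have p0 := valP p; have o0 := valP o2.
have [k kG [k1 k2]] := SLZ_reduction p0; have dk := SLZ_det kG.
set z := mob k (val p) in k1 k2.
have z0 : 0 < z.2 by rewrite mob_gt0.
have [c cs /(resmx_eq N0 (s1 _ cs) kG)] := s2 _ kG.
have cG := s1 _ cs; have dc := SLZ_det cG.
rewrite -toCV // -toCM => ckG.
exists (mobH (c^-1 * k)); first by exists (c^-1 * k).
have uc : c \is a GRing.unit by rewrite unitmxE dc unitr1.
have uk : k \is a GRing.unit by rewrite unitmxE dk unitr1.
have dcV : \det c^-1 = 1 by rewrite invr_adj2 // det_adj2.
have zY : z.2 <= Y.
  have vz0 : 0 < (vplane z).2 by [].
  have dkV : \det k^-1 = 1 by rewrite invr_adj2 // det_adj2.
  have g'G : Gamma1 (g * toC k^-1) by apply: Gamma1M; [exact: Gam_Gamma1 gG | exact: SLZV].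
  have qz : val q = poincare (g * toC k^-1) (vplane z).
    rewrite qE /z vplane_mob -poincareM ?det_mulr2 ?det_toC ?dk ?dkV ?mulr1 ?gG.1 //.
    by rewrite -mulrA -toCM mulVr // toC1 mulr1.
  have E0 : 0 < E by exact: expR_gt0.
  have q1 : t0 <= 2 * E * (val q).2 by exact: (cosh3_height (valP o3) (valP q) oq).
  have q2 : (val q).2 <= 2 * E * t0.
    by apply: (cosh3_height (valP q) (valP o3)); rewrite cosh3_sym.
  have := Gamma1_height g'G vz0; rewrite -qz /Y => -[h|h].
    rewrite (le_trans h) // (le_trans q2) // lerDr divr_ge0 ?mulr_ge0 ?ltW //.
  apply: (@le_trans _ _ (2 * E / t0)); last by rewrite lerDl !mulr_ge0 ?ltW.
  rewrite ler_pdivlMr //; change (is_true (z.2 * (val q).2 <= 1)%R) in h; move: h q1.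
  change ((vplane z).2) with z.2; clear -z0 E0; clearbody z.
  move: (val q).2 z.2 z0 => u v v0 vu ut.
  have : v * t0 <= v * (2 * E * u) by rewrite ler_wpM2l ?(ltW v0).
  have : E * (v * u) <= E * 1 by rewrite ler_wpM2l ?(ltW E0).
  lra.
have C : cosh2 (val o2) (val (mobH (c^-1 * k) p)) = cosh2 (mob c (val o2)) z.
  rewrite val_mobH ?det_mulr2 ?dcV ?dk ?mulr1 // mobM // -/z -(@cosh2_mob _ c) ?mob_gt0 //.
  by rewrite -[mob c (mob _ _)]mobM ?divrr // ?mob1.
have CM : cosh2 (mob c (val o2)) z <= M.
  clear C; clearbody z; apply: le_trans (hM _ cs); rewrite /B /cosh2.
  have w0 : 0 < (mob c (val o2)).2 by rewrite mob_gt0.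
  move: (mob c (val o2)) w0 => [u v] /= v0; rewrite lerD2l.
  have n1 : (u - z.1) ^+ 2 <= (`|u| + 2^-1) ^+ 2.
    rewrite -real_normK ?num_real // ler_sqr ?nnegrE ?addr_ge0 //.
    by rewrite (le_trans (ler_normB _ _)) // lerD2l.
  have n2 : (v - z.2) ^+ 2 <= (v + Y) ^+ 2.
    have : 0 <= (Y + z.2) * (2 * v + Y - z.2) by apply: mulr_ge0; lra.
    lra.
  have vz : 0 < 2 * v * z.2 by rewrite !mulr_gt0.
  apply: ler_pM.
  - by rewrite addr_ge0 ?sqr_ge0.
  - rewrite invr_ge0. exact: ltW.
  - exact: lerD.
  - by rewrite lef_pV2 ?posrE //; nra.
rewrite dist2E C arcosh_le //; first by rewrite cosh2_ge1 // mob_gt0.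
by rewrite (le_trans _ CM) // cosh2_ge1 // mob_gt0.
Qed.

End Proper.

(** * The maximal order of 2 x 2 matrices over the Gaussian integers *)

Section AlgebraicIntegers.
Variable k : fieldType.
Implicit Types x y : k.

Lemma ai0 : algebraic_integer (0 : k). Proof. exact: (mxpoly.integral0 (intr : {rmorphism int -> k})). Qed.
Lemma ai1 : algebraic_integer (1 : k). Proof. exact: (mxpoly.integral1 (intr : {rmorphism int -> k})). Qed.
Lemma aiD x y : algebraic_integer x -> algebraic_integer y -> algebraic_integer (x + y).
Proof. exact: (mxpoly.integral_add (RtoK := (intr : {rmorphism int -> k}))). Qed.
Lemma aiN x : algebraic_integer x -> algebraic_integer (- x).
Proof. exact: (mxpoly.integral_opp (RtoK := (intr : {rmorphism int -> k}))). Qed.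
Lemma aiM x y : algebraic_integer x -> algebraic_integer y -> algebraic_integer (x * y).
Proof. exact: (mxpoly.integral_mul (RtoK := (intr : {rmorphism int -> k}))). Qed.
Lemma ai_sum (I : Type) (r : seq I) (P : pred I) (F : I -> k) :
  (forall i, P i -> algebraic_integer (F i)) -> algebraic_integer (\sum_(i <- r | P i) F i).
Proof. by move=> h; apply: big_ind => //; [exact: ai0 | exact: aiD]. Qed.

Lemma ai_char_poly n (C : 'M[k]_n) : (forall i j, algebraic_integer (C i j)) ->
  forall l, algebraic_integer (char_poly C)`_l.
Proof.
move=> hC; pose Q (p : {poly k}) := forall l, algebraic_integer p`_l.
have Q0 : Q 0 by move=> l; rewrite coef0; exact: ai0.
have Q1 : Q 1 by move=> l; rewrite coef1; case: eqP => _; [exact: ai1 | exact: ai0].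
have QD p q : Q p -> Q q -> Q (p + q) by move=> hp hq l; rewrite coefD; exact: aiD.
have QN p : Q p -> Q (- p) by move=> hp l; rewrite coefN; exact: aiN.
have QM p q : Q p -> Q q -> Q (p * q).
  by move=> hp hq l; rewrite coefM; apply: ai_sum => i _; exact: aiM.
have QX : Q 'X by move=> l; rewrite coefX; case: eqP => _; [exact: ai1 | exact: ai0].
have QC c : algebraic_integer c -> Q c%:P.
  by move=> hc l; rewrite coefC; case: eqP => _ //; exact: ai0.
suff : Q (char_poly C) by [].
rewrite /char_poly /determinant; apply: big_ind => // s _; apply: (QM).
  by elim: (nat_of_bool (perm.odd_perm s)) => [|m ih]; rewrite ?expr0 // exprS; apply: (QM) => //; exact: QN.
apply: big_ind => // i _; rewrite !mxE; apply: (QD); last exact/QN/QC.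
by case: eqP => _; rewrite ?mulr1n ?mulr0n.
Qed.

(** The characteristic polynomial is monic with integral coefficients, and a root of such a
    polynomial is integral over the integers. *)
Lemma ai_eigenvalue n (C : 'M[k]_n) (v : 'rV[k]_n) y :
  (forall i j, algebraic_integer (C i j)) -> v != 0 -> v *m C = y *: v -> algebraic_integer y.
Proof.
move=> hC v0 vC; apply: (mxpoly.integral_root_monic (RtoK := (intr : {rmorphism int -> k})) (char_poly_monic C)).
  by rewrite -eigenvalue_root_char; apply/eigenvalueP; exists v.
by apply/integral_poly => i; exact: ai_char_poly.
Qed.

Local Notation A := ('M[k]_2 : falgType k).

Definition integral_matrices : set A := [set x | forall i j, algebraic_integer ((x : 'M[k]_2) i j)].

Definition delta_tuple : 4.-tuple A :=
  [tuple of [:: delta_mx 0 0; delta_mx 0 1; delta_mx 1 0; delta_mx 1 1 : 'M[k]_2]].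

Lemma matrix2_delta (x : 'M[k]_2) : x = x 0 0 *: delta_mx 0 0 + (x 0 1 *: delta_mx 0 1 +
   (x 1 0 *: delta_mx 1 0 + x 1 1 *: delta_mx 1 1)).
Proof.
by apply: matrix2P; rewrite !mxE /= ?mulr0 ?mulr1 ?addr0 ?add0r.
Qed.

Lemma span_delta_tuple : <<delta_tuple>>%VS = fullv.
Proof.
apply/vspaceP => x; rewrite memvf; rewrite [x]matrix2_delta.
by do !apply: memvD; apply: memvZ; apply: memv_span; rewrite !inE eqxx ?orbT.
Qed.

Lemma integral_matrices_order : is_order integral_matrices.
Proof.
split.
- move=> i j; rewrite mxE; case: eqP => _; [exact: ai1 | exact: ai0].
- by move=> x y hx hy i j; rewrite mulmx2E; apply: aiD; exact: aiM.
exists 4%N, delta_tuple; split; first exact: span_delta_tuple.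
move=> x; split=> [hx | [c [hc ->]]].
  exists (fun i : 'I_4 => tnth [tuple of [:: x 0 0; x 0 1; x 1 0; x 1 1]] i); split.
    by case=> [[|[|[|[|//]]]]] ? /=; rewrite (tnth_nth 0); exact: hx.
  rewrite {1}[x]matrix2_delta !big_ord_recl big_ord0 addr0.
  by rewrite !(tnth_nth 0).
move=> i j; rewrite summxE; apply: ai_sum => l _; rewrite mxE; apply: aiM => //.
rewrite (tnth_nth 0); case: l => [[|[|[|[|//]]]]] ? /=; rewrite !mxE;
 by case: (_ && _); [exact: ai1 | exact: ai0].
Qed.

(* If y E_00 lies in an order B, then multiplication by y preserves the (0, 0)-entries of B, a
   finitely generated module over the integers, so y is an integer by Cayley-Hamilton. *)
Lemma integral_matrices_maximal : maximal_order integral_matrices.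
Proof.
split; first exact: integral_matrices_order.
move=> B [B1 BM [n [e [_ BE]]]] sub; apply/seteqP; split=> // x Bx i j.
pose E a b : 'M[k]_2 := delta_mx a b.
have OE a b : B (E a b).
  by apply: sub => c d; rewrite mxE; case: (_ && _); [exact: ai1 | exact: ai0].
set y := x i j.
have yE : B (y *: E 0 0).
  have -> : y *: E 0 0 = E 0 i * x * E j 0.
    apply/matrixP => a b; rewrite !mulmx2E !mxE /y.
    have [-> | ->] : i = 0 \/ i = 1 by case: (i) => [[|[|//]]] ?; [left|right]; exact/val_inj.
      have [-> | ->] : j = 0 \/ j = 1 by case: (j) => [[|[|//]]] ?; [left|right]; exact/val_inj.
        by case: (a == 0); case: (b == 0); rewrite /= ?(mulr0, mul0r, mulr1, mul1r, addr0, add0r).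
      by case: (a == 0); case: (b == 0); rewrite /= ?(mulr0, mul0r, mulr1, mul1r, addr0, add0r).
    have [-> | ->] : j = 0 \/ j = 1 by case: (j) => [[|[|//]]] ?; [left|right]; exact/val_inj.
      by case: (a == 0); case: (b == 0); rewrite /= ?(mulr0, mul0r, mulr1, mul1r, addr0, add0r).
    by case: (a == 0); case: (b == 0); rewrite /= ?(mulr0, mul0r, mulr1, mul1r, addr0, add0r).
  by apply: (BM) => //; exact: (BM).
have eO l : B (tnth e l).
  apply/BE; exists (fun l' => (l' == l)%:R); split.
    by move=> l'; case: eqP => _; [exact: ai1 | exact: ai0].
  rewrite (bigD1 l) //= eqxx scale1r big1 ?addr0 // => l' /negbTE ->.
  by rewrite scale0r.
have H l : exists c : 'I_n -> k, (forall i, algebraic_integer (c i)) /\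
   (y *: E 0 0) * tnth e l = \sum_i c i *: tnth e i.
  by apply/BE; apply: (BM).
(* [C] is the matrix of left multiplication by y E_00 on the generators and [v] the row of their (0,
   0)-entries, so v C = y v; v is nonzero because 1 lies in B. *)
pose C : 'M[k]_n := \matrix_(i, l) projT1 (cid (H l)) i.
pose v : 'rV[k]_n := \row_l (tnth e l : 'M[k]_2) 0 0.
apply: (@ai_eigenvalue n C v).
- by move=> a b; rewrite mxE; case: (cid (H b)) => c [].
- apply/eqP => v0; have [c [_ cE]] := (BE 1).1 B1.
  have : (1 : 'M[k]_2) 0 0 = 0.
    rewrite cE summxE big1 // => l _; rewrite mxE.
    have := erefl (v 0 l); rewrite {1}v0 !mxE => <-; exact: mulr0.
  by rewrite mxE eqxx => /eqP; rewrite oner_eq0.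
apply/rowP => l; rewrite !mxE.
have [_ cE] := projT2 (cid (H l)).
have : ((y *: E 0 0) * (tnth e l : 'M[k]_2)) 0 0 = y * (tnth e l : 'M[k]_2) 0 0.
  by rewrite mulmx2E !mxE /= mulr1 mulr0 mul0r addr0.
rewrite cE => <-; rewrite summxE; apply: eq_bigr => a _; rewrite !mxE mulrC //.
Qed.

End AlgebraicIntegers.

Lemma rat_algebraic_integer (q : rat) : algebraic_integer q -> q \is a Num.int.
Proof.
move=> [p pm pq].
have : root (map_poly (intr : int -> algC) p) (ratr q).
  rewrite /root; have -> : map_poly (intr : int -> algC) p = map_poly ratr (map_poly (intr : int -> rat) p).
    by rewrite -map_poly_comp; apply: eq_map_poly => z /=; rewrite ratr_int.
  by rewrite horner_map (eqP pq) rmorph0.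
move=> /root_monic_Aint -/(_ _ _) h.
have : ratr q \in Aint.
  apply: h; first exact: monic_map.
  by apply/polyOverP => i; rewrite coef_map /=; exact: intr_int.
move=> /(Cint_rat_Aint (Crat_rat q)) /intrP[m]; rewrite -ratr_int => /fmorph_inj ->.
exact: intr_int.
Qed.

(** * The field Q(i), its complex place and its integers *)

Lemma rat_sq_neqN1 (q : rat) : q * q != -1.
Proof. by rewrite -expr2; apply/eqP => h; have := sqr_ge0 q; rewrite h. Qed.

Lemma gaussian_field : exists (k : fieldExtType rat) (z : k),
  z * z = -1 /\ basis_of fullv [:: 1; z].
Proof.
pose p : {poly rat} := 'X^2 + 1.
have sp : size p = 3%N by rewrite size_addl size_polyXn // size_poly1.
have ip : irreducible_poly p.
  apply: cubic_irreducible; first by rewrite sp.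
  move=> x; apply/negP; rewrite /root !hornerE => /eqP h.
  by have := sqr_ge0 x; lra.
have [L dimL [z rz spanz]] := irredp_FAdjoin ip.
rewrite sp /= in dimL.
have zz : z * z = -1.
  move: rz; rewrite /root /p rmorphD /= map_polyXn rmorph1 !hornerE => /eqP /eqP.
  by rewrite addr_eq0 -expr2 => /eqP.
exists L, z; split=> //.
rewrite basisEfree dimL leqnn subvf !andbT.
rewrite free_cons span_seq1 seq1_free.
have z0 : z != 0 by apply/eqP => z0; move: zz; rewrite z0 mul0r => /eqP; rewrite eq_sym oppr_eq0 oner_eq0.
rewrite z0 andbT; apply/negP => /vlineP[q qz].
have q0 : q != 0 by apply/eqP => q0; move: qz; rewrite q0 scale0r => /eqP; rewrite oner_eq0.
have zq : (q^-1)%:A = z by rewrite qz scalerA mulVf // scale1r.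
have : in_alg L (q^-1 * q^-1) = in_alg L (-1) by rewrite rmorphM rmorphN1 /= zq.
by move=> /fmorph_inj/eqP; rewrite (negbTE (rat_sq_neqN1 _)).
Qed.

Section GaussianEmbedding.
Variables (R : realType) (k : fieldExtType rat) (z : k).
Hypotheses (zz : z * z = -1) (zb : basis_of fullv [:: 1; z]).

Let b : 2.-tuple k := [tuple 1; z].
Definition repart (x : k) : rat := coord b 0 x.
Definition impart (x : k) : rat := coord b 1 x.

Lemma gaussianE x : x = (repart x)%:A + impart x *: z.
Proof.
have : x \in <<b>>%VS by rewrite (span_basis zb) memvf.
move/coord_span => {1}->; rewrite !big_ord_recl big_ord0 addr0.
by rewrite /repart /impart; congr (_ *: _ + coord b _ _ *: _); exact: val_inj.
Qed.

Lemma gaussian_coord (u v : rat) : repart (u%:A + v *: z) = u /\ impart (u%:A + v *: z) = v.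
Proof.
have fb : free b by exact: basis_free zb.
have c1 (i : 'I_2) : coord b i 1 = (0 == i)%:R by exact: (coord_free 0 i fb).
have cz (i : 'I_2) : coord b i z = (1 == i)%:R by exact: (coord_free 1 i fb).
rewrite /repart /impart !linearD !linearZ /= !c1 !cz /=.
by rewrite !mulr1 !mulr0 addr0 add0r.
Qed.

Definition gtau (x : k) : R[i] := ratr (repart x) +i* ratr (impart x).

Lemma gtauE u v : gtau (u%:A + v *: z) = ratr u +i* ratr v.
Proof. by have [h1 h2] := gaussian_coord u v; rewrite /gtau h1 h2. Qed.

Lemma gtau_is_zmod_morphism : zmod_morphism gtau.
Proof.
move=> x y; rewrite {1}(gaussianE x) {1}(gaussianE y).
have -> : (repart x)%:A + impart x *: z - ((repart y)%:A + impart y *: z) =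
  (repart x - repart y)%:A + (impart x - impart y) *: z.
  by rewrite !scalerBl opprD addrACA.
rewrite gtauE !rmorphB /=; apply/eqP; rewrite eq_complex /=.
by rewrite !eqxx.
Qed.

Lemma gtau_is_monoid_morphism : monoid_morphism gtau.
Proof.
split.
  have -> : (1 : k) = 1%:A + 0 *: z by rewrite scale1r scale0r addr0.
  by rewrite gtauE rmorph1 rmorph0.
move=> x y; rewrite {1}(gaussianE x) {1}(gaussianE y).
have -> : ((repart x)%:A + impart x *: z) * ((repart y)%:A + impart y *: z) =
  (repart x * repart y - impart x * impart y)%:A + (repart x * impart y + impart x * repart y) *: z.
  rewrite -!(mulr_algl _ z) !scalerBl !scalerDl.
  have aM (u v : rat) : (u * v)%:A = u%:A * v%:A :> k by exact: (rmorphM (in_alg k)).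
  rewrite !aM; move: (repart x)%:A (impart x)%:A (repart y)%:A (impart y)%:A => a c a' c'.
  transitivity (a * a' + c * c' * (z * z) + (a * c' + c * a') * z); first by ring.
  by rewrite zz; ring.
rewrite gtauE rmorphB !rmorphD !rmorphM /=; apply/eqP; rewrite eq_complex /=.
by rewrite !eqxx.
Qed.

HB.instance Definition _ := GRing.isZmodMorphism.Build k R[i] gtau gtau_is_zmod_morphism.
HB.instance Definition _ := GRing.isMonoidMorphism.Build k R[i] gtau gtau_is_monoid_morphism.

Definition gaussian_embedding : {rmorphism k -> R[i]} := gtau.

Lemma gaussian_embedding_z : gaussian_embedding z = 'i%C.
Proof.
rewrite /gaussian_embedding /=.
have -> : z = 0%:A + 1 *: z by rewrite scale0r scale1r add0r.
by rewrite gtauE rmorph0 rmorph1.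
Qed.

Lemma morph_alg (K : fieldType) (f : {rmorphism k -> K}) (q : rat) : f q%:A = ratr q.
Proof. exact: (fmorph_eq_rat (f \o in_alg k)). Qed.

Lemma morphE (K : fieldType) (f : {rmorphism k -> K}) x :
  f x = ratr (repart x) + ratr (impart x) * f z.
Proof. by rewrite {1}(gaussianE x) -(mulr_algl (impart x) z) rmorphD rmorphM !morph_alg. Qed.

(** An embedding is determined by the image of z, a square root of -1, hence i or -i. *)
Lemma gaussian_unique_complex_place : unique_complex_place gaussian_embedding.
Proof.
split; first by exists z; rewrite gaussian_embedding_z /= oner_eq0.
move=> f _; have : f z ^+ 2 = 'i%C ^+ 2 by rewrite sqr_i -rmorphXn expr2 zz rmorphN1.
move/eqP; rewrite eqf_sqr => /orP[] /eqP fz; [left|right] => x.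
  by rewrite (morphE f) (morphE gaussian_embedding) fz gaussian_embedding_z.
rewrite (morphE f) (morphE gaussian_embedding) fz gaussian_embedding_z.
have ratC (q : rat) : ratr q = (ratr q)%:C :> R[i] by rewrite fmorph_rat.
by rewrite !ratC conjcD conjcM !conjc_real; congr (_ + _ * _); apply/eqP; rewrite eq_complex /= !oppr0 !eqxx.
Qed.

Lemma gaussian_no_real_place : {rmorphism k -> R} -> False.
Proof.
move=> f; have := sqr_ge0 (f z); rewrite expr2 -rmorphM zz rmorphN1; lra.
Qed.

Lemma matrix_quaternion_algebra : quaternion_algebra ('M[k]_2 : falgType k).
Proof.
exists 1, 1, (mx2 1 0 0 (-1)), (mx2 0 1 1 0); split.
- by rewrite oner_eq0.
- by rewrite scale1r mul_mx2 mx2_1; apply: matrix2P; rewrite !mx2E; ring.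
- by rewrite scale1r mul_mx2 mx2_1; apply: matrix2P; rewrite !mx2E; ring.
- by rewrite !mul_mx2; apply: matrix2P; rewrite [in RHS]mxE !mx2E; ring.
rewrite basisEdim; apply/andP; split; last by rewrite dimvf dim_matrix.
apply/subvP => x _.
have two : 2 != 0 :> k by rewrite -(rmorph_nat (in_alg k)) fmorph_eq0 pnatr_eq0.
have -> : x = ((x 0 0 + x 1 1) / 2) *: 1 + (((x 0 0 - x 1 1) / 2) *: mx2 1 0 0 (-1) +
  (((x 0 1 + x 1 0) / 2) *: mx2 0 1 1 0 + ((x 0 1 - x 1 0) / 2) *: (mx2 1 0 0 (-1) * mx2 0 1 1 0))).
  by rewrite mul_mx2 mx2_1; apply: matrix2P; rewrite !mxE /=; field.
by do !apply: memvD; apply: memvZ; apply: memv_span; rewrite !inE eqxx ?orbT.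
Qed.

End GaussianEmbedding.

Lemma algebraic_integer_morph (F K : fieldType) (f : {rmorphism F -> K}) (x : F) :
  algebraic_integer (f x) <-> algebraic_integer x.
Proof.
have e (p : {poly int}) : root (map_poly (intr : int -> K) p) (f x) = root (map_poly (intr : int -> F) p) x.
  rewrite /root -(fmorph_eq0 f) -horner_map -map_poly_comp.
  by congr ((_).[_] == 0); apply: eq_map_poly => z /=; rewrite rmorph_int.
by split=> -[p pm pr]; exists p => //; [rewrite -e | rewrite e].
Qed.

(** Squares are 0 or 1 modulo 4. This is what rules out half-integral coordinates for the integers
    of Q(i). *)
Lemma even_of_sum_squares (m l n : int) : m * m + l * l = 4 * n ->
  exists m' l' : int, m = 2 * m' /\ l = 2 * l'.
Proof.
move=> e; exists (m %/ 2)%Z, (l %/ 2)%Z.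
have em := divz_eq m 2; have el := divz_eq l 2.
have rm : ((m %% 2)%Z = 0 \/ (m %% 2)%Z = 1) by lia.
have rl : ((l %% 2)%Z = 0 \/ (l %% 2)%Z = 1) by lia.
move: (m %/ 2)%Z (m %% 2)%Z (l %/ 2)%Z (l %% 2)%Z em el rm rl => a r b s em el rm rl.
suff : r = 0 /\ s = 0 by move=> [r0 s0]; split; lia.
move: e; rewrite em el.
have -> : (a * 2 + r) * (a * 2 + r) + (b * 2 + s) * (b * 2 + s) =
   4 * (a * a + a * r + b * b + b * s) + r * r + s * s :> int by ring.
move: (a * a + a * r + b * b + b * s) => c.
by case: rm => ->; case: rl => ->; lia.
Qed.

Section GaussianIntegers.
Variables (R : realType) (k : fieldExtType rat) (z : k).
Hypotheses (zz : z * z = -1) (zb : basis_of fullv [:: 1; z]).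
Local Notation tau := (gaussian_embedding R zz zb).

Lemma ai_int (K : fieldType) (m : int) : algebraic_integer (m%:~R : K).
Proof. exact: (integral_id (intr : {rmorphism int -> K})). Qed.

Lemma ai_z : algebraic_integer z.
Proof.
exists ('X^2 + 1); first by rewrite monicE lead_coefDl ?lead_coefXn // size_polyXn size_poly1.
by rewrite /root rmorphD /= map_polyXn rmorph1 !hornerE expr2 zz addNr.
Qed.

Lemma gaussian_embedding_coord x :
  tau x = ratr (repart z x) +i* ratr (impart z x).
Proof. by []. Qed.

Lemma gint_preimage w : gint w -> exists2 x, algebraic_integer x & tau x = w.
Proof.
case: w => u v /andP[/= /intrP[m ->] /intrP[n ->]].
exists (m%:~R%:A + n%:~R *: z).
  rewrite -(mulr_algl _ z).
  have e (l : int) : (l%:~R)%:A = l%:~R :> k by exact: (rmorph_int (in_alg k)).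
  by rewrite !e; apply: aiD; [exact: ai_int | apply: aiM; [exact: ai_int | exact: ai_z]].
have [h1 h2] := gaussian_coord zb m%:~R n%:~R.
by rewrite gaussian_embedding_coord h1 h2 !ratr_int.
Qed.

Lemma trace_int x : algebraic_integer x -> exists m : int, 2 * repart z x = m%:~R.
Proof.
move=> hx.
have h1 : algebraic_integer (tau x) by apply/algebraic_integer_morph.
have h2 : algebraic_integer (conjc (tau x)) by apply/(algebraic_integer_morph (@conjc R : {rmorphism R[i] -> R[i]})).
have : algebraic_integer (ratr (2 * repart z x) : R[i]).
  have -> : ratr (2 * repart z x) = tau x + conjc (tau x).
    rewrite gaussian_embedding_coord -(fmorph_rat (real_complex R)).
    have -> : ratr (2 * repart z x) = 2 * ratr (repart z x) :> R by rewrite rmorphM rmorph_nat.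
    by apply/eqP; rewrite eq_complex /=; apply/andP; split; apply/eqP; ring.
  exact: aiD.
move/algebraic_integer_morph/rat_algebraic_integer => /intrP[m ->]; by exists m.
Qed.

Lemma norm_int x : algebraic_integer x ->
  exists m : int, repart z x ^+ 2 + impart z x ^+ 2 = m%:~R.
Proof.
move=> hx.
have h1 : algebraic_integer (tau x) by apply/algebraic_integer_morph.
have h2 : algebraic_integer (conjc (tau x)) by apply/(algebraic_integer_morph (@conjc R : {rmorphism R[i] -> R[i]})).
have : algebraic_integer (ratr (repart z x ^+ 2 + impart z x ^+ 2) : R[i]).
  have -> : ratr (repart z x ^+ 2 + impart z x ^+ 2) = tau x * conjc (tau x).
    rewrite gaussian_embedding_coord -(fmorph_rat (real_complex R)).
    have -> : ratr (repart z x ^+ 2 + impart z x ^+ 2) = ratr (repart z x) ^+ 2 + ratr (impart z x) ^+ 2 :> R.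
      by rewrite rmorphD !rmorphXn.
    by apply/eqP; rewrite eq_complex /=; apply/andP; split; apply/eqP; ring.
  exact: aiM.
by move/algebraic_integer_morph/rat_algebraic_integer => /intrP[m ->]; exists m.
Qed.

Lemma repart_mulz x : repart z (x * z) = - impart z x.
Proof.
rewrite {1}(gaussianE zb x) mulrDl -scalerAl mul1r -scalerAl zz scalerN -scaleNr addrC.
by have [] := gaussian_coord zb (- impart z x) (repart z x).
Qed.

(** The traces of x and of x z and the norm of x are rational algebraic integers. So twice each
    coordinate is an integer, and the squares of these doubles add up to 4 times an integer, which
    makes them even. *)
Lemma gaussian_integer x : algebraic_integer x -> gint (tau x).
Proof.
move=> hx; have [m hm] := trace_int hx.
have [l hl] := trace_int (aiM hx ai_z); have [n hn] := norm_int hx.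
rewrite repart_mulz in hl.
have e : m * m + l * l = 4 * n.
  apply: (@intr_inj rat); rewrite rmorphD !rmorphM /= -hm -hl -hn; ring.
have [m' [l' [em el]]] := even_of_sum_squares e.
have hr : repart z x = m'%:~R.
  by move: hm; rewrite em rmorphM /= => /(mulfI _) ->.
have hi : impart z x = (- l')%:~R.
  by move: hl; rewrite el rmorphM mulrN /= => h; rewrite rmorphN /=; lra.
by rewrite gaussian_embedding_coord hr hi !ratr_int /gint /= !intr_int.
Qed.

Lemma norm_one_group_gaussian :
  norm_one_group (map_mx tau : {rmorphism ('M[k]_2 : falgType k) -> 'M[R[i]]_2}) (@integral_matrices k)
  = @Gamma1 R.
Proof.
apply/seteqP; split=> [_ [x [hx _ _ dx] <-]|g [dg hg]].
  by split=> // i j; rewrite mxE; exact: gaussian_integer.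
pose x : 'M[k]_2 := \matrix_(i, j) s2val (cid2 (gint_preimage (hg i j))).
have hx i j : algebraic_integer (x i j) by rewrite mxE; case: (cid2 _).
have xg : map_mx tau x = g by apply/matrixP => i j; rewrite !mxE; case: (cid2 _).
have dx : \det x = 1.
  by apply: (fmorph_inj tau); rewrite -det_map_mx xg dg rmorph1.
exists x => //; split=> //.
- by rewrite unitmxE dx unitr1.
- rewrite invr_adj2 //; move=> i j; rewrite /adj2 mxE; do 2 case: ifP => _ //; try exact: aiN; exact: hx.
- by rewrite /= xg.
Qed.

End GaussianIntegers.

(** * Arithmeticity of the congruence groups *)

Section ArithmeticManifold.
Variable R : realType.

(** The inverse sends y to the combination, with the entries of y as coefficients, of the coordinate
    rows of the matrix units. As [vbasis] is an unspecified basis, both composites are computed by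
    expanding it and the matrix units in each other. *)
Lemma map_mx_identification (k K : fieldType) (f : {rmorphism k -> K}) :
  matrix_identification f (map_mx f : {rmorphism ('M[k]_2 : falgType k) -> 'M[K]_2}).
Proof.
split=> [c|].
  by apply/matrixP => i j; rewrite !mxE rmorphM /=; case: eqP => _; rewrite ?rmorph1 ?rmorph0 ?mulr1 ?mulr0.
set A := ('M[k]_2 : falgType k); pose n := \dim (fullv : {vspace A}).
pose e : n.-tuple A := vbasis fullv.
pose tb (x : A) : 'rV[K]_n := \row_l f (coord e l x).
have tbS (I : Type) (r : seq I) (P : pred I) (c : I -> k) (x : I -> A) :
    \sum_(i <- r | P i) f (c i) *: tb (x i) = tb (\sum_(i <- r | P i) c i *: x i).
  apply/rowP => l; rewrite summxE mxE linear_sum rmorph_sum.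
  by apply: eq_bigr => i _; rewrite !mxE linearZ rmorphM.
have deltaE (S : pzRingType) (x : 'M[S]_2) : x = \sum_p x p.1 p.2 *: delta_mx p.1 p.2.
  by rewrite {1}[x]matrix_sum_delta pair_bigA.
have eb : basis_of fullv e by exact: vbasisP.
have ef : free e by exact: basis_free eb.
have eE (x : A) : x = \sum_l coord e l x *: e`_l.
  by apply: coord_span; rewrite (span_basis eb) memvf.
exists (fun y : 'M[K]_2 => \sum_p y p.1 p.2 *: tb (delta_mx p.1 p.2)) => [x|y].
  transitivity (\sum_l x 0 l *: tb e`_l).
    transitivity (\sum_(p : 'I_2 * 'I_2) \sum_l (x 0 l * f ((e`_l : 'M[k]_2) p.1 p.2)) *: tb (delta_mx p.1 p.2)).
      apply: eq_bigr => p _; rewrite summxE scaler_suml; apply: eq_bigr => l _.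
      by congr (_ *: _); rewrite !mxE.
    rewrite exchange_big; apply: eq_bigr => l _ /=.
    rewrite [in RHS](deltaE _ (e`_l : 'M[k]_2)) -tbS scaler_sumr.
    by apply: eq_bigr => p _; rewrite scalerA.
  rewrite [RHS]row_sum_delta; apply: eq_bigr => l _; congr (_ *: _).
  by apply/rowP => m; rewrite !mxE (coord_free l m ef) rmorph_nat /= eq_sym.
transitivity (\sum_(p : 'I_2 * 'I_2) y p.1 p.2 *: map_mx f (delta_mx p.1 p.2)); last first.
  by rewrite [RHS]deltaE; apply: eq_bigr => p _; rewrite map_delta_mx.
transitivity (\sum_l \sum_(p : 'I_2 * 'I_2) (y p.1 p.2 * f (coord e l (delta_mx p.1 p.2))) *: map_mx f (e`_l : 'M[k]_2)).
  by apply: eq_bigr => l _; rewrite summxE scaler_suml; apply: eq_bigr => p _; congr (_ *: _); rewrite !mxE.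
rewrite exchange_big; apply: eq_bigr => p _ /=.
rewrite [in RHS](eE (delta_mx p.1 p.2)) raddf_sum scaler_sumr.
apply: eq_bigr => l _; rewrite -scalerA; congr (_ *: _).
by symmetry; exact: (map_mxZ f).
Qed.

Lemma arithmetic_hyperbolic_Gam N : (3 <= N)%N -> arithmetic_hyperbolic_3manifold (@Gam R N).
Proof.
move=> N3; split; last exact: psl_torsion_free_Gam.
split; [exact: psl_subgroup_Gam | exact: discrete_Gam |].
have [k [z [zz zb]]] := gaussian_field.
pose tau := gaussian_embedding R zz zb.
have index_refl (G : set 'M[R[i]]_2) : psl_subgroup G -> finite_index G G.
  (* [psl_subgroup] provides -1 directly, so -1 represents the only coset. *)
  move=> [Gdet GN1 GM GV]; split=> //; exists [:: -1]; split=> [h|g Gg].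
    by rewrite inE => /eqP ->.
  by exists (-1); [rewrite inE | apply: GM => //; exact: GV].
exists k, tau, ('M[k]_2 : falgType k), (map_mx tau : {rmorphism ('M[k]_2 : falgType k) -> 'M[R[i]]_2}), (@integral_matrices k).
split.
- exact: gaussian_unique_complex_place.
- split; first exact: matrix_quaternion_algebra.
  by move=> sigma; case: (gaussian_no_real_place zz sigma).
- exact: map_mx_identification.
- exact: integral_matrices_maximal.
rewrite norm_one_group_gaussian; exists 1; first by rewrite det1.
have -> : conjugate_set 1 (@Gamma1 R) = @Gamma1 R.
  apply/seteqP; split=> [_ [g gG <-]|g gG]; first by rewrite mul1r invr1 mulr1.
  by exists g => //; rewrite mul1r invr1 mulr1.
have -> : @Gam R N `&` @Gamma1 R = @Gam R N.
  by apply/setIidl => g; exact: Gam_Gamma1.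
split; first exact/index_refl/psl_subgroup_Gam.
exact/finite_index_Gam/(leq_trans _ N3).
Qed.

End ArithmeticManifold.

(** * Hyperbolic area *)

Section Density.
Local Open Scope ereal_scope.

Context d (T : measurableType d) (R : realType).
Variables (mu nu : {measure set T -> \bar R}) (rho : T -> R).
Hypotheses (mrho : measurable_fun setT rho) (rho0 : forall x, (0 <= rho x)%R).
Hypothesis nuE : forall A, measurable A -> nu A = \int[mu]_(x in A) (rho x)%:E.

Import HBNNSimple.

(** True for indicators by [nuE], for simple functions by linearity, and in general by monotone
    convergence. *)
Lemma ge0_integral_density (f : T -> \bar R) :
  measurable_fun setT f -> (forall x, 0 <= f x) ->
  \int[nu]_x f x = \int[mu]_x (f x * (rho x)%:E).
Proof.
move=> mf f0; pose h := nnsfun_approx measurableT mf.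
have mr : measurable_fun setT (EFin \o rho) by exact/measurable_EFinP.
have cvh x : EFin \o h^~ x @ \oo --> f x by exact: cvg_nnsfun_approx.
have ndh x a b : (a <= b)%N -> (h a x <= h b x)%R by move=> ab; exact/lefP/nd_nnsfun_approx.
transitivity (limn (fun n => \int[nu]_x (h n x)%:E)).
  rewrite -monotone_convergence//.
  - by apply: eq_integral => x _; apply/esym/cvg_lim => //; exact: cvh.
  - by move=> n; exact/measurable_EFinP.
  - by move=> n x _; rewrite lee_fin.
  - by move=> x _ a b ab; rewrite lee_fin; exact: ndh.
transitivity (limn (fun n => \int[mu]_x ((h n x)%:E * (rho x)%:E))); last first.
  rewrite -monotone_convergence//.
  - by apply: eq_integral => x _; apply/cvg_lim => //; apply: cvgeZr => //; exact: cvh.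
  - by move=> n; apply: emeasurable_funM => //; exact/measurable_EFinP.
  - by move=> n x _; rewrite mule_ge0 ?lee_fin.
  - by move=> x _ a b ab; rewrite lee_wpmul2r ?lee_fin //; exact: ndh.
congr (limn _); apply/funext => n.
have mI r : measurable_fun setT (fun x => (r * \1_(h n @^-1` [set r]) x)%:E).
  by apply/measurable_EFinP/measurable_funM.
transitivity (\sum_(r \in range (h n)) \int[nu]_x (r * \1_(h n @^-1` [set r]) x)%:E).
  rewrite -ge0_integral_fsum//; last by move=> r x _; exact: nnfun_muleindic_ge0.
  by apply: eq_integral => x _; rewrite fsumEFin// -fimfunE.
transitivity (\sum_(r \in range (h n)) \int[mu]_x ((r * \1_(h n @^-1` [set r]) x)%:E * (rho x)%:E)); last first.
  rewrite -ge0_integral_fsum//.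
  - apply: eq_integral => x _; rewrite -ge0_mule_fsuml; last by move=> r; exact: nnfun_muleindic_ge0.
    by rewrite fsumEFin// -fimfunE.
  - by move=> r; apply: emeasurable_funM.
  - by move=> r x _; apply: mule_ge0; [exact: nnfun_muleindic_ge0 | rewrite lee_fin].
apply: eq_fsbigr => r /[!inE] -[t _ <-].
rewrite integralZl_indic_nnsfun// integral_indic// setIT nuE//.
under [in RHS]eq_integral do rewrite EFinM -muleA.
rewrite ge0_integralZl ?lee_fin//.
- congr (_ * _); rewrite [LHS]integral_mkcond; apply: eq_integral => x _.
  by rewrite patchE indicE; case: ifPn => _; rewrite ?mul1e ?mul0e.
- by apply: emeasurable_funM => //; exact/measurable_EFinP.
- by move=> x _; rewrite mule_ge0 ?lee_fin.
Qed.

End Density.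

Section DensityMeasure.
Local Open Scope ereal_scope.
Context d (T : measurableType d) (R : realType).
Variables (mu : {measure set T -> \bar R}) (rho : T -> R).
Hypotheses (mrho : measurable_fun setT rho) (rho0 : forall x, (0 <= rho x)%R).

(** The two proofs are arguments so that a measure structure can be attached to the set function. *)
Definition mdensity of measurable_fun setT rho & (forall x, (0 <= rho x)%R) :=
  fun A => \int[mu]_(x in A) (rho x)%:E.

Let m := mdensity mrho rho0.

Let m0 : m set0 = 0. Proof. exact: integral_set0. Qed.

Let m_ge0 A : 0 <= m A.
Proof. by apply: integral_ge0 => x _; rewrite lee_fin. Qed.

Let m_sigma_additive : semi_sigma_additive m.
Proof.
move=> F mF tF mUF; rewrite /m /mdensity ge0_integral_bigcup//.
- by apply: is_cvg_ereal_nneg_natsum_cond => n _ _; exact: m_ge0.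
- by apply: measurable_funTS; exact/measurable_EFinP.
- by move=> x _; rewrite lee_fin.
Qed.

HB.instance Definition _ := isMeasure.Build _ _ _ m m0 m_ge0 m_sigma_additive.

End DensityMeasure.

Section ExpSubstitution.
Local Open Scope ereal_scope.
Variable R : realType.
Local Notation leb := (@lebesgue_measure R).

Definition recip (y : R) : R := (expR (- ln y) * \1_(`]0%R, +oo[) y)%R.

Lemma recipE y : (0 < y)%R -> recip y = (y^-1)%R.
Proof.
by move=> y0; rewrite /recip indicE mem_set ?mulr1 /= ?in_itv /= ?y0 // expRN lnK.
Qed.

Lemma recip_npos y : (y <= 0)%R -> recip y = 0%R.
Proof.
move=> y0; rewrite /recip indicE memNset ?mulr0 //=.
by rewrite in_itv /= andbT; apply/negP; rewrite -leNgt.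
Qed.

Lemma recip_ge0 y : (0 <= recip y)%R.
Proof. by rewrite mulr_ge0 ?expR_ge0 // indicE. Qed.

Lemma measurable_recip : measurable_fun setT (recip : measurableTypeR R -> measurableTypeR R).
Proof.
apply: measurable_funM => //.
by apply: measurableT_comp => //; apply: measurableT_comp.
Qed.

Let D := mdensity leb measurable_recip recip_ge0.

Let lnT : measurableTypeR R -> measurableTypeR R := @ln R.
Let measurable_lnT : measurable_fun setT lnT. Proof. exact: measurable_ln. Qed.
HB.instance Definition _ := isMeasurableFun.Build _ _ _ _ lnT measurable_lnT.

(** The image of dy / y under ln is ds: by uniqueness of Lebesgue measure half-open intervals
    suffice, and the integral of 1 / y from e^a to e^b is b - a. *)
Lemma lebesgue_ln A : measurable A -> leb A = pushforward D lnT A.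
Proof.
move=> mA; apply: (lebesgue_measure_unique (mu := pushforward D lnT)) => //.
move=> _ [[a b] _ <-] /=.
have [ab|ba] := ltP a b; last first.
  have -> : `]a, b]%classic = set0 :> set R by apply: set_itv_ge; rewrite bnd_simp -leNgt.
  by rewrite /pushforward preimage_set0 measure0 /mdensity integral_set0.
rewrite lebesgue_measure_itv /= lte_fin ab /pushforward /mdensity.
have eab : (expR a < expR b)%R by rewrite ltr_expR.
transitivity (\int[leb]_(y in `[expR a, expR b]) (y^-1)%:E).
  rewrite (@continuous_FTC2 _ _ (@ln R)) // ?expRK ?EFinB //.
  - apply: continuous_in_subspaceT => y; rewrite inE /= in_itv /= => /andP[ya _].
    by apply: inv_continuous; rewrite gt_eqF // (lt_le_trans (expR_gt0 a)).
  - split.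
    + move=> y; rewrite in_itv /= => /andP[ya _].
      by apply: ex_derive; apply: is_derive1_ln; rewrite (lt_trans (expR_gt0 a)).
    + by apply: cvg_at_right_filter; apply: continuous_ln; exact: expR_gt0.
    + by apply: cvg_at_left_filter; apply: continuous_ln; exact: expR_gt0.
  - move=> y; rewrite in_itv /= => /andP[ya _].
    by rewrite derive1E; apply: derive_val; apply: is_derive1_ln; rewrite (lt_trans (expR_gt0 a)).
transitivity (\int[leb]_(y in `[expR a, expR b]) (recip y)%:E).
  apply: eq_integral => y; rewrite inE /= in_itv /= => /andP[ya _].
  by rewrite recipE // (lt_le_trans (expR_gt0 a)).
rewrite -integral_itv_obnd_cbnd; last first.
  by apply: measurable_funTS; apply/measurable_EFinP; exact: measurable_recip.
rewrite [LHS]integral_mkcond [RHS]integral_mkcond; congr (integral _ _ _); apply/funext => y.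
(* For y <= 0 the value of [ln] is a default that may fall in the interval, but there [recip]
   vanishes. *)
rewrite !patchE; have [y0|y0] := leP y 0%R.
  by rewrite (recip_npos y0) !if_same.
congr (if _ then _ else _); apply/idP/idP; rewrite !inE /= !in_itv /= /lnT.
  by rewrite -{1 2}[y]lnK ?posrE // ltr_expR ler_expR.
by rewrite -{3 4}[y]lnK ?posrE // ltr_expR ler_expR.
Qed.

(* recip is 1 / y cut off to 0 on y <= 0, so the right-hand integral runs over y > 0. *)
Lemma exp_substitution (g : measurableTypeR R -> \bar R) : measurable_fun setT g ->
  (forall y, 0 <= g y) -> \int[leb]_s g (expR s) = \int[leb]_y (g y * (recip y)%:E).
Proof.
move=> mg g0.
have mge : measurable_fun setT (fun s : measurableTypeR R => g (expR s)) by exact: measurableT_comp.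
transitivity (\int[pushforward D lnT]_s g (expR s)).
  by apply: eq_measure_integral => A mA _; exact: lebesgue_ln.
rewrite ge0_integral_pushforward // preimage_setT.
rewrite (@ge0_integral_density _ _ _ leb D recip measurable_recip recip_ge0) //.
- apply: eq_integral => y _ /=; have [y0|y0] := leP y 0%R.
    by rewrite recip_npos // !mule0.
  by rewrite /lnT lnK.
- by apply: measurableT_comp.
- by move=> y; exact: g0.
Qed.

End ExpSubstitution.

Section LebesgueAffine.
Local Open Scope ereal_scope.
Variable R : realType.
Local Notation leb := (@lebesgue_measure R).
Local Notation MR := (measurableTypeR R).

Lemma lebesgue_shift (c : R) (A : set MR) : measurable A -> leb [set x | A (x + c)%R] = leb A.
Proof.
move=> mA; pose f (x : MR) : MR := (x + c)%R.
have mf : measurable_fun setT f by exact: measurable_funD.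
pose f' : {mfun MR >-> MR} := HB.pack f (isMeasurableFun.Build _ _ _ _ f mf).
symmetry; apply: (lebesgue_measure_unique (mu := pushforward leb f')) => //.
move=> _ [[a b] _ <-] /=; change (leb `]a, b] = leb (f @^-1` `]a, b])).
have -> : f @^-1` `]a, b]%classic = `](a - c)%R, (b - c)%R]%classic.
  by apply/seteqP; split => x /=; rewrite !in_itv /= /f ltrBlDr lerBrDr.
rewrite !lebesgue_measure_itv /= !lte_fin ltrD2r; case: ifP => // _.
by rewrite -!EFinD opprD opprK addrACA addNr addr0.
Qed.

Lemma lebesgue_opp (A : set MR) : measurable A -> leb [set x | A (- x)%R] = leb A.
Proof. exact: lebesgue_measureN. Qed.

Lemma lebesgue_scale (k : R) (A : set MR) : (0 < k)%R -> measurable A ->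
  k%:E * leb [set x | A (x * k)%R] = leb A.
Proof.
move=> k0 mA; pose f (x : MR) : MR := (x * k)%R.
have mf : measurable_fun setT f by exact: measurable_funM.
pose f' : {mfun MR >-> MR} := HB.pack f (isMeasurableFun.Build _ _ _ _ f mf).
pose k' : {nonneg R} := NngNum (ltW k0).
symmetry; apply: (lebesgue_measure_unique (mu := mscale k' (pushforward leb f'))) => //.
move=> _ [[a b] _ <-] /=; change (leb `]a, b] = k%:E * leb (f @^-1` `]a, b])).
have -> : f @^-1` `]a, b]%classic = `](a / k)%R, (b / k)%R]%classic.
  by apply/seteqP; split => x /=; rewrite !in_itv /= /f ltr_pdivrMr // ler_pdivlMr.
rewrite !lebesgue_measure_itv /= !lte_fin ltr_pM2r ?invr_gt0 //; case: ifP => _; last by rewrite mule0.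
by rewrite -!EFinD -EFinM; congr EFin; field; rewrite gt_eqF.
Qed.

End LebesgueAffine.

Section HyperbolicArea.
Local Open Scope ereal_scope.
Variable R : realType.
Local Notation leb := (@lebesgue_measure R).
Local Notation MR := (measurableTypeR R).
Local Notation leb2 := ((leb \x leb)%E).

Lemma leb2_ysection (A : set (MR * MR)) : measurable A -> leb2 A = \int[leb]_y leb (ysection A y).
Proof.
move=> mA; have m1 : measurable_fun setT (fun p : MR * MR => (\1_A p)%:E : \bar R).
  by apply/measurable_EFinP.
transitivity (\int[leb2]_p (\1_A p)%:E); first by rewrite integral_indic // setIT.
rewrite fubini_tonelli2 //.
apply: eq_integral => y _; rewrite /fubini_G.
transitivity (\int[leb]_x (\1_(ysection A y) x)%:E).
  by apply: eq_integral => x _; rewrite !indicE mem_ysection.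
by rewrite integral_indic // ?setIT //; exact: measurable_ysection.
Qed.

(* In the coordinates m = x / y and s = ln y the area form dx dy / y^2 is dm ds, and the isometries
   of the half-plane are compositions of measure-preserving shears. *)
Definition logcoord (p : MR * MR) : MR * MR := ((p.1 * expR p.2)%R, expR p.2).

Lemma measurable_logcoord : measurable_fun setT logcoord.
Proof.
apply/measurable_fun_pair => /=.
  by apply: measurable_funM => //; apply: measurableT_comp.
by apply: measurableT_comp.
Qed.

(** At fixed y the scaling x = m y absorbs one factor 1 / y of the density, and the substitution y =
    e^s absorbs the other. *)
Lemma area2E (S : set (MR * MR)) : measurable S -> (forall p, S p -> (0 < p.2)%R) ->
  area2 S = leb2 (logcoord @^-1` S).
Proof.
move=> mS S0.
pose w (y : MR) : MR := expR (-2 * ln y)%R.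
have mw : measurable_fun setT w by apply: measurableT_comp => //; exact: measurable_funM.
have wE y : (0 < y)%R -> w y = (y ^- 2)%R.
  by move=> y0; rewrite /w -ln_powR // lnK ?posrE ?powR_gt0 // powRN powR_mulrn // ltW.
pose f (p : MR * MR) : \bar R := (\1_S p * w p.2)%:E.
have mf : measurable_fun setT f.
  apply/measurable_EFinP/measurable_funM; first exact: measurable_indic.
  exact: measurableT_comp.
have f0 p : 0 <= f p by rewrite lee_fin mulr_ge0 ?expR_ge0 // indicE.
transitivity (\int[leb2]_p f p).
  rewrite /area2 [LHS]integral_mkcond; apply: eq_integral => p _.
  rewrite patchE /f indicE; case: ifPn => pS; last by rewrite mul0r.
  by rewrite mul1r wE // S0 //; exact: set_mem.
rewrite fubini_tonelli2 //.
pose psi (p : MR * MR) : MR * MR := ((p.1 * p.2)%R, p.2).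
have mpsi : measurable_fun setT psi.
  by apply/measurable_fun_pair => //=; exact: measurable_funM.
have mpS : measurable (psi @^-1` S) by rewrite -[X in measurable X]setTI; exact: mpsi.
have mlS : measurable (logcoord @^-1` S) by rewrite -[X in measurable X]setTI; exact: measurable_logcoord.
pose g y := leb (ysection (psi @^-1` S) y).
have mg : measurable_fun setT g by exact: measurable_fun_ysection.
transitivity (\int[leb]_y (g y * (recip y)%:E)).
  apply: eq_integral => y _; rewrite /fubini_G /f.
  transitivity (\int[leb]_x ((w y)%:E * (\1_(ysection S y) x)%:E)).
    by apply: eq_integral => x _; rewrite !indicE mem_ysection -EFinM mulrC.
  have mSy : measurable (ysection S y) by exact: measurable_ysection.
  rewrite ge0_integralZl ?lee_fin ?expR_ge0 //; last first.
    by apply/measurable_EFinP.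
  rewrite integral_indic // setIT.
  have [y0|y0] := leP y 0%R.
    rewrite recip_npos // mule0.
    have -> : ysection S y = set0.
      by apply/seteqP; split=> x //; rewrite /ysection /= inE => /S0 /=; rewrite ltNge y0.
    by rewrite measure0 mule0.
  rewrite recipE // wE //; change ((y ^- 2)%:E * leb (ysection S y) = g y * (y^-1)%:E).
  rewrite -(lebesgue_scale y0 mSy) muleA -EFinM muleC.
  congr (_ * _); last by congr EFin; field; rewrite gt_eqF.
have g0 y : 0 <= g y by exact: measure_ge0.
rewrite -(exp_substitution mg g0) (leb2_ysection mlS).
by apply: eq_integral => s _; rewrite /g; apply: (congr1 leb); apply/seteqP; split=> x; rewrite /ysection /= !inE.
Qed.

End HyperbolicArea.

(** * Invariance of the area: isometries as shears *)

Section Lifts.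
Local Open Scope ereal_scope.
Variable R : realType.
Local Notation leb := (@lebesgue_measure R).
Local Notation MR := (measurableTypeR R).
Local Notation leb2 := ((leb \x leb)%E).

Definition preserves_leb2 (phi : MR * MR -> MR * MR) : Prop :=
  measurable_fun setT phi /\ forall A, measurable A -> leb2 (phi @^-1` A) = leb2 A.

Lemma preserves_leb2_comp phi psi : preserves_leb2 phi -> preserves_leb2 psi ->
  preserves_leb2 (phi \o psi).
Proof.
move=> [mphi ephi] [mpsi epsi]; split; first exact: measurableT_comp.
move=> A mA; have mpA : measurable (phi @^-1` A) by rewrite -[X in measurable X]setTI; exact: mphi.
by rewrite -[RHS]ephi // -[RHS]epsi.
Qed.

Lemma shear_fst (f : MR -> MR -> MR) :
  measurable_fun setT (fun p : MR * MR => (f p.2 p.1, p.2)) ->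
  (forall y (B : set MR), measurable B -> leb [set x | B (f y x)] = leb B) ->
  preserves_leb2 (fun p => (f p.2 p.1, p.2)).
Proof.
set phi := fun p : MR * MR => _; move=> mphi hf; split=> // A mA.
have mpA : measurable (phi @^-1` A) by rewrite -[X in measurable X]setTI; exact: mphi.
rewrite [LHS]leb2_ysection // [RHS]leb2_ysection //; apply: eq_integral => y _.
rewrite -[RHS](hf y); last exact: measurable_ysection.
by congr (leb _); apply/seteqP; split=> x; rewrite /ysection /= !inE.
Qed.

Lemma shear_snd (f : MR -> MR -> MR) :
  measurable_fun setT (fun p : MR * MR => (p.1, f p.1 p.2)) ->
  (forall x (B : set MR), measurable B -> leb [set y | B (f x y)] = leb B) ->
  preserves_leb2 (fun p => (p.1, f p.1 p.2)).
Proof.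
set phi := fun p : MR * MR => _; move=> mphi hf; split=> // A mA.
have mpA : measurable (phi @^-1` A) by rewrite -[X in measurable X]setTI; exact: mphi.
apply: eq_integral => x _ /=.
rewrite -[RHS](hf x); last exact: measurable_xsection.
by congr (leb _); apply/seteqP; split=> y; rewrite /xsection /= !inE.
Qed.

Definition lifts (g : 'M[R]_2) (phi : MR * MR -> MR * MR) : Prop :=
  preserves_leb2 phi /\ forall p, logcoord (phi p) = mob g (logcoord p).

Lemma lifts_comp g h phi psi : \det g = 1%R -> \det h = 1%R ->
  lifts g phi -> lifts h psi -> lifts (g * h)%R (phi \o psi).
Proof.
move=> dg dh [pphi ephi] [ppsi epsi]; split; first exact: preserves_leb2_comp.
by move=> p; rewrite /= ephi epsi mobM //= expR_gt0.
Qed.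

Lemma lifts_trans (b : R) : exists phi, lifts (mx2 1 b 0 1)%R phi.
Proof.
exists (fun p : MR * MR => ((p.1 + b * expR (- p.2))%R, p.2)); split.
  apply: (@shear_fst (fun y x => (x + b * expR (- y))%R)).
    apply/measurable_fun_pair => //=; apply: measurable_funD => //.
    by apply: measurable_funM => //; apply: measurableT_comp => //; apply: measurableT_comp.
  by move=> y B mB; exact: lebesgue_shift.
move=> [m s]; rewrite mob_trans /logcoord /=; congr (_, _).
by rewrite mulrDl -mulrA -expRD addNr expR0 mulr1.
Qed.

Lemma lifts_diag (a : R) : (a != 0)%R -> exists phi, lifts (mx2 a 0 0 a^-1)%R phi.
Proof.
move=> a0; have a2 : (0 < a ^+ 2)%R by rewrite exprn_even_gt0.
exists (fun p : MR * MR => (p.1, (p.2 + ln (a ^+ 2))%R)); split.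
  apply: (@shear_snd (fun x y => (y + ln (a ^+ 2))%R)).
    by apply/measurable_fun_pair => //=; apply: measurable_funD.
  by move=> y B mB; exact: lebesgue_shift.
move=> [m s]; rewrite /logcoord /mob /mobden2 !mx2E /= expRD lnK ?posrE //.
by congr (_, _); field.
Qed.

(** Inversion sends x / y to its opposite and y to 1 / (y (1 + m^2)) with m = x / y: a shear in s
    followed by a reflection in m. *)
Lemma lifts_inv : exists phi, lifts (mx2 0 (-1) 1 0)%R phi.
Proof.
pose phi1 (p : MR * MR) : MR * MR := ((- p.1)%R, p.2).
pose phi2 (p : MR * MR) : MR * MR := (p.1, (- (p.2 + ln (1 + p.1 ^+ 2)))%R).
exists (phi1 \o phi2); split.
  apply: preserves_leb2_comp.
    apply: (@shear_fst (fun y x => (- x)%R)).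
      by apply/measurable_fun_pair => //=; exact: measurableT_comp.
    by move=> y B mB; exact: lebesgue_opp.
  apply: (@shear_snd (fun x y => (- (y + ln (1 + x ^+ 2)))%R)).
    apply/measurable_fun_pair => //=; apply: measurableT_comp => //.
    apply: measurable_funD => //; apply: measurableT_comp => //.
    by apply: measurable_funD => //; exact: measurable_funX.
  move=> x B mB.
  have mB' : measurable [set y : MR | B (- y)%R].
    by rewrite -[X in measurable X]setTI; exact: (@oppr_measurable R setT).
  by rewrite -[RHS]lebesgue_opp // -[RHS](lebesgue_shift (ln (1 + x ^+ 2))).
move=> [m s]; rewrite mob_inv /logcoord /phi1 /phi2 /=.
have m1 : (0 < 1 + m ^+ 2)%R by rewrite ltr_wpDr // sqr_ge0.
rewrite !expRN expRD lnK ?posrE //; have s0 := expR_gt0 s.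
have nz : ((m * expR s) ^+ 2 + expR s ^+ 2 != 0 :> R)%R by rewrite gt_eqF // ltr_wpDl ?sqr_ge0 ?exprn_gt0.
by congr (_, _); field; rewrite nz !gt_eqF.
Qed.

(** Bruhat decomposition: a matrix with c = 0 is a translation times a diagonal matrix; any other
    one has the inversion between such a product and a further translation. *)
Lemma exists_lift (g : 'M[R]_2) : \det g = 1%R -> exists phi, lifts g phi.
Proof.
move=> dg; rewrite (mx2_eta g) in dg *; move: (g 0 0)%R (g 0 1)%R (g 1 0)%R (g 1 1)%R dg => a b c d.
rewrite det_mx2 => dg.
have [c0|c0] := eqVneq c 0%R.
  move: dg; rewrite c0 mulr0 subr0 => ad.
  have a0 : (a != 0)%R by apply: contra_eq_neq ad => ->; rewrite mul0r eq_sym oner_eq0.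
  have -> : mx2 a b 0%R d = (mx2 1 (a * b) 0 1 * mx2 a 0 0 a^-1)%R.
    have -> : d = (a^-1)%R by rewrite -[d]mul1r -(mulVf a0) -mulrA ad mulr1.
    by rewrite mul_mx2; apply: matrix2P; rewrite !mx2E; field.
  have [phi1 h1] := lifts_trans (a * b)%R; have [phi2 h2] := lifts_diag a0.
  exists (phi1 \o phi2); apply: lifts_comp => //; rewrite det_mx2; first by ring.
  by field.
have ci0 : (c^-1 != 0)%R by rewrite invr_eq0.
have [phi1 h1] := lifts_trans (a / c)%R; have [phi2 h2] := lifts_diag ci0.
have [phi3 h3] := lifts_inv; have [phi4 h4] := lifts_trans (d / c)%R.
rewrite invrK in h2.
have -> : mx2 a b c d = (mx2 1 (a / c) 0 1 * (mx2 c^-1 0 0 c * (mx2 0 (-1) 1 0 * mx2 1 (d / c) 0 1)))%R.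
  rewrite !mul_mx2; apply: matrix2P; rewrite !mx2E; try by field.
  have -> : (b = (a * d - 1) / c)%R by rewrite -dg; field.
  by field.
exists (phi1 \o (phi2 \o (phi3 \o phi4))).
have d1 x : \det (mx2 1 x 0 1 : 'M[R]_2)%R = 1%R by rewrite det_mx2; ring.
have d2 : \det (mx2 c^-1 0 0 c)%R = 1%R by rewrite det_mx2; field.
have d3 : \det (mx2 0 (-1) 1 0 : 'M[R]_2)%R = 1%R by rewrite det_mx2; ring.
by do !(apply: lifts_comp; rewrite ?det_mulr2 ?d1 ?d2 ?d3 ?mulr1 //).
Qed.

End Lifts.

Section OrbitMeasure.
Local Open Scope ereal_scope.
Context d (T : measurableType d) (R : realType) (mu : {measure set T -> \bar R}).

Lemma measure_bigsetU_le (I : Type) (s : seq I) (A : I -> set T) : (forall i, measurable (A i)) ->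
  mu (\big[setU/set0]_(i <- s) A i) <= \sum_(i <- s) mu (A i).
Proof.
move=> mA; elim: s => [|i s ih]; first by rewrite !big_nil measure0.
rewrite !big_cons; apply: le_trans (leeD2l _ ih); apply: measureU2 => //.
exact: bigsetU_measurable.
Qed.

(* The pieces of X attached to one class are carried to disjoint subsets of D. *)
Lemma orbit_measure_bound (I : finType) (c : nat -> I) (phi psi : nat -> T -> T) (X D : set T) :
  measurable X -> measurable D ->
  (forall n, measurable_fun setT (phi n)) -> (forall n, measurable_fun setT (psi n)) ->
  (forall n A, measurable A -> mu (psi n @^-1` A) = mu A) ->
  (forall n q, phi n (psi n q) = q) ->
  (forall p, X p -> exists n, D (phi n p)) ->
  (forall n m p q, c n = c m -> X p -> X q -> phi n p = phi m q -> p = q) ->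
  mu X <= \sum_(i : I) mu D.
Proof.
move=> mX mD mphi mpsi mupsi phiK cover inj.
pose F i n := X `&` (if c n == i then phi n @^-1` D else set0).
have mF i n : measurable (F i n).
  apply: measurableI => //; case: ifP => _ //.
  by rewrite -[Y in measurable Y]setTI; exact: mphi.
have mY i n : measurable (seqDU (F i) n) by apply: seqDU_measurable.
have mZ i n : measurable (psi n @^-1` seqDU (F i) n).
  by rewrite -[Y in measurable Y]setTI; exact: mpsi.
have FY i n p : seqDU (F i) n p -> F i n p by case.
have bound i : mu (\bigcup_n F i n) <= mu D.
  rewrite seqDU_bigcup_eq measure_semi_bigcup //; last 1 first.
  - exact: bigcup_measurable.
  (* Pulling a piece back by [psi n] keeps its measure and carries it into [D]; a point common to
     two pulled-back pieces would, by [inj], come from a point common to the disjoint pieces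
     themselves. *)
  have -> : \sum_(n <oo) mu (seqDU (F i) n) = \sum_(n <oo) mu (psi n @^-1` seqDU (F i) n).
    by apply: eq_eseriesr => n _; rewrite mupsi.
  rewrite -measure_semi_bigcup //; last 2 first.
  - apply/trivIsetP => n m _ _ nm; apply/seteqP; split=> // q [qn qm].
    have [[Xn /= +] [Xm /= +]] := (FY _ _ _ qn, FY _ _ _ qm).
    case: eqP => // cn _; case: eqP => // cm _.
    have e : psi n q = psi m q by apply: (inj n m) => //; [rewrite cn cm | rewrite !phiK].
    have /trivIsetP/(_ n m Logic.I Logic.I nm) E := trivIset_seqDU (F i).
    rewrite -[set0]/(set0 : set T) in E.
    have : (seqDU (F i) n `&` seqDU (F i) m) (psi n q) by split=> //; rewrite e.
    by rewrite E.
  - exact: bigcup_measurable.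
  apply: le_measure; rewrite ?inE //; first exact: bigcup_measurable.
  move=> q [n _ /= /FY[_]]; case: eqP => // _ /=; by rewrite phiK.
apply: (@le_trans _ _ (mu (\big[setU/set0]_(i <- enum I) \bigcup_n F i n))).
  apply: le_measure; rewrite ?inE //.
    by apply: bigsetU_measurable => i _; exact: bigcup_measurable.
  move=> p Xp; have [n Dp] := cover _ Xp.
  rewrite -bigcup_seq; exists (c n); first by rewrite /= mem_enum.
  by exists n => //; split=> //; rewrite eqxx.
apply: (le_trans (measure_bigsetU_le _ _)); first by move=> i; exact: bigcup_measurable.
by rewrite big_enum /=; apply: lee_sum => i _; exact: bound.
Qed.

End OrbitMeasure.

(** * Finite area of the real surface, and the area of a rectangle *)

Section FiniteArea.
Local Open Scope ereal_scope.
Variable R : realType.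
Local Notation leb := (@lebesgue_measure R).
Local Notation MR := (measurableTypeR R).
Local Notation leb2 := ((leb \x leb)%E).

Definition cusp_box : set (MR * MR) := [set p | (`|p.1| <= 2^-1)%R /\ (2^-1 <= p.2)%R].

Lemma measurable_cusp_box : measurable cusp_box.
Proof.
have -> : cusp_box = `[(- 2^-1)%R, 2^-1%R]%classic `*` `[2^-1%R, +oo[%classic.
  by apply/seteqP; split=> -[x y] /=; rewrite /cusp_box /= !in_itv /= andbT ler_norml => -[].
by apply: measurableX; exact: measurable_itv.
Qed.

(** The slice at s is |m| <= e^-s / 2, of length e^-s, for s >= - ln 2, and is empty below. *)
Lemma leb2_cusp_box : leb2 (@logcoord R @^-1` cusp_box) < +oo.
Proof.
have mD : measurable (@logcoord R @^-1` cusp_box).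
  rewrite -[X in measurable X]setTI; apply: measurable_logcoord => //; exact: measurable_cusp_box.
rewrite leb2_ysection //.
pose a := ln (2^-1 : R).
have Da s : leb (ysection (@logcoord R @^-1` cusp_box) s) = (if (a <= s)%R then (expR (- s))%:E else 0).
  have e0 := expR_gt0 s.
  case: ifPn => as_.
    have -> : ysection (@logcoord R @^-1` cusp_box) s = `[(- (2^-1 * expR (- s)))%R, (2^-1 * expR (- s))%R]%classic.
      apply/seteqP; split=> m; rewrite /ysection /= inE /= in_itv /= -ler_norml.
        by move=> [+ _]; rewrite /= normrM (gtr0_norm e0) expRN ler_pdivlMr.
      move=> h; split; first by rewrite /= normrM (gtr0_norm e0) -ler_pdivlMr // -expRN.
      by rewrite /= -[X in (X <= _)%R]lnK ?posrE // ler_expR.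
    rewrite lebesgue_measure_itv /= lte_fin.
    have h0 : (0 < 2^-1 * expR (- s))%R by rewrite mulr_gt0 ?expR_gt0.
    by rewrite ifT; [rewrite -EFinD; congr EFin; lra | lra].
  have -> : ysection (@logcoord R @^-1` cusp_box) s = set0; last by rewrite measure0.
  apply/seteqP; split=> m //; rewrite /ysection /= inE /= => -[_ /= h].
  by move/negP: as_; apply; rewrite -ler_expR lnK ?posrE.
under eq_integral do rewrite Da.
have -> : \int[leb]_s (if (a <= s)%R then (expR (- s))%:E else 0) =
    \int[leb]_(s in `[a, +oo[) (expR (- s))%:E.
  by rewrite [RHS]integral_mkcond; apply: eq_integral => s _; rewrite patchE mem_setE in_itv /= andbT.
rewrite (@ge0_continuous_FTC2y _ (fun s => expR (- s)) (fun s => - expR (- s))%R a 0%R).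
- by rewrite -EFinB ltry.
- by move=> s _; exact: expR_ge0.
- by apply: continuous_subspaceT => s; apply: continuous_comp; [exact: oppr_continuous | exact: continuous_expR].
- rewrite -oppr0; apply: cvgN; exact: cvgr_expR.
- by move=> s _; apply: ex_derive.
- apply: cvg_at_right_filter; apply: cvgN; apply: continuous_comp; [exact: oppr_continuous | exact: continuous_expR].
- move=> s _; rewrite derive1E; apply: derive_val.
  by apply: is_derive_eq; rewrite mulrN1 opprK.
Qed.

(** Countability, as a sequence indexing the pieces in [orbit_measure_bound]; a number that codes no
    element of the group is sent to 1. *)
Lemma enumerate_SLZ : exists e : nat -> 'M[R]_2, (forall n, SLZ (e n)) /\
  forall g, SLZ g -> exists n, e n = g.
Proof.
pose mxz (x : int * int * int * int) : 'M[R]_2 :=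
  let: (a, b, c, d) := x in mx2 a%:~R b%:~R c%:~R d%:~R.
pose e n := if @unpickle (int * int * int * int)%type n is Some x then
  (if `[< SLZ (mxz x) >] then mxz x else 1%R) else 1%R.
exists e; split=> [n|g gS].
  rewrite /e; case: unpickle => [x|]; last exact: SLZ1.
  by case: asboolP => // _; exact: SLZ1.
have hi i j : exists m : int, g i j = m%:~R.
  have [_ hg] := gS; have := hg i j; rewrite mxE /gint /= => /andP[/intrP[m ->] _].
  by exists m.
have [a ha] := hi 0%R 0%R; have [b hb] := hi 0%R 1%R.
have [c hc] := hi 1%R 0%R; have [d hd] := hi 1%R 1%R.
have gE : mxz (a, b, c, d) = g by rewrite /mxz -ha -hb -hc -hd -mx2_eta.
exists (pickle (a, b, c, d)); rewrite /e pickleK gE.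
by case: asboolP.
Qed.

Lemma logcoord_inj : injective (@logcoord R).
Proof.
move=> [m s] [m' s'] [+ /expR_inj ss']; rewrite ss' => /mulIf -> //.
by rewrite gt_eqF // expR_gt0.
Qed.

(** Every set that injects into the quotient has area at most the number of residue matrices times
    the area of the box. Two elements of one class that send p and q to the same point differ by an
    element of the group taking q to p, whence p = q. *)
Lemma surface_area_GamZ_lty N : (0 < N)%N -> surface_area (@GamZ R N) < +oo.
Proof.
move=> N0; have [e [eS eonto]] := enumerate_SLZ.
have ed n := SLZ_det (eS n).
have eVd n : \det (e n)^-1 = 1%R by exact/SLZ_det/SLZV.
pose phi n := projT1 (cid (exists_lift (ed n))).
pose psi n := projT1 (cid (exists_lift (eVd n))).
have phiP n : lifts (e n) (phi n) := projT2 (cid (exists_lift (ed n))).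
have psiP n : lifts (e n)^-1 (psi n) := projT2 (cid (exists_lift (eVd n))).
have ue n : e n \is a GRing.unit by rewrite unitmxE ed unitr1.
have log0 p : (0 < (@logcoord R p).2)%R by exact: expR_gt0.
pose I : finType := {ffun 'I_2 * 'I_2 -> 'I_N.-1.+1 * 'I_N.-1.+1}.
apply: (@le_lt_trans _ _ (\sum_(i : I) leb2 (@logcoord R @^-1` cusp_box))); last first.
  apply: lte_sum_pinfty => i _; exact: leb2_cusp_box.
apply: ge_ereal_sup => _ [B [mB injB] <-].
set S := [set val p | p in B] in mB *.
have S0 (p : MR * MR) : S p -> (0 < p.2)%R by move=> [q _ <-]; exact: (valP q).
rewrite area2E //.
have mX : measurable (@logcoord R @^-1` S).
  by rewrite -[X in measurable X]setTI; apply: measurable_logcoord.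
have mD : measurable (@logcoord R @^-1` cusp_box).
  by rewrite -[X in measurable X]setTI; apply: measurable_logcoord => //; exact: measurable_cusp_box.
apply: (@orbit_measure_bound _ _ _ _ I (fun n => resmx N (toC (e n))) phi psi) => //.
- by move=> n; case: (phiP n) => -[].
- by move=> n; case: (psiP n) => -[].
- by move=> n; case: (psiP n) => -[].
- move=> n q; apply: logcoord_inj; rewrite (phiP n).2 (psiP n).2 -mobM ?ed ?eVd //.
  by rewrite divrr // mob1.
- move=> p [q _ qE]; have [g gS [g1 g2]] := @SLZ_reduction R _ (log0 p).
  have [n nE] := eonto _ gS; exists n.
  by change (cusp_box (logcoord (phi n p))); rewrite (phiP n).2 nE; split.
move=> n m p q nm [p' Bp pE] [q' Bq qE] h.
apply: logcoord_inj; rewrite -pE -qE.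
have hG : Gam N (toC ((e n)^-1 * e m)%R).
  by rewrite toCM toCV //; exact: (resmx_eq N0 (eS n) (eS m) nm).
have f_q : val (mobH ((e n)^-1 * e m) q') = val p'.
  rewrite val_mobH ?det_mulr2 ?ed ?eVd ?mulr1 // qE mobM ?ed ?eVd // -(phiP m).2 -h (phiP n).2.
  by rewrite -mobM ?ed ?eVd // mulVr // mob1.
have := injB (mobH ((e n)^-1 * e m)%R) q' _ Bq.
rewrite (val_inj f_q) => H; rewrite H //.
by exists ((e n)^-1 * e m)%R.
Qed.

(** The Euclidean area is 2 a y^2 and the density is at least (2 y)^-2. *)
Lemma rectangle_area (x y a : R) : (0 < y)%R -> (0 < a)%R ->
  (a / 2)%:E <= area2 ((`[(x - a * y)%R, (x + a * y)%R] `*` `[y, (2 * y)%R])%classic : set (MR * MR)).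
Proof.
move=> y0 a0; set Q := (_ `*` _)%classic.
have mQ : measurable (Q : set (MR * MR)) by apply: measurableX; exact: measurable_itv.
have Q0 p : Q p -> (y <= p.2 <= 2 * y)%R by case => _ /=; rewrite in_itv.
pose w (u : MR) : MR := expR (-2 * ln u)%R.
have mw : measurable_fun setT w by apply: measurableT_comp => //; exact: measurable_funM.
have wE u : (0 < u)%R -> w u = (u ^- 2)%R.
  by move=> u0; rewrite /w -ln_powR // lnK ?posrE ?powR_gt0 // powRN powR_mulrn // ltW.
have -> : area2 Q = \int[leb2]_(p in Q) (w p.2)%:E.
  apply: eq_integral => p; rewrite inE => /Q0/andP[h _].
  by rewrite wE // (lt_le_trans y0).
apply: (@le_trans _ _ (\int[leb2]_(p in Q) ((2 * y) ^- 2)%:E)).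
  rewrite integral_cst // [X in _ * X](_ : _ = leb `[(x - a * y)%R, (x + a * y)%R] * leb `[y, (2 * y)%R]); last first.
    by apply: product_measure1E; exact: measurable_itv.
  rewrite !lebesgue_measure_itv /= !lte_fin.
  have ay : (0 < a * y)%R by rewrite mulr_gt0.
  rewrite !ifT; [|lra|lra]; rewrite -!EFinD -!EFinM lee_fin.
  by rewrite le_eqVlt; apply/orP; left; apply/eqP; field; rewrite gt_eqF.
apply: ge0_le_integral => //.
- by move=> p _; rewrite lee_fin invr_ge0 sqr_ge0.
- by apply/measurable_EFinP/measurable_funTS; exact: measurableT_comp.
- move=> p /Q0/andP[h1 h2]; have p0 : (0 < p.2)%R by exact: lt_le_trans h1.
  by rewrite lee_fin wE // lef_pV2 ?posrE ?exprn_gt0 ?mulr_gt0 // ler_sqr ?nnegrE // ?ltW ?mulr_gt0.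
Qed.

End FiniteArea.

(** * The lower bound on the systole *)

Section Systole.
Variable R : realType.

(** The differences of coordinates are at most 2 a y and y, and the denominator is at least 2 y^2;
    the quotient is thus at most (4 a^2 + 1) / 2. *)
Lemma cosh2_rectangle (x y a : R) (p q : R * R) : 0 < y -> 0 < a ->
  `|p.1 - x| <= a * y -> y <= p.2 <= 2 * y -> `|q.1 - x| <= a * y -> y <= q.2 <= 2 * y ->
  cosh2 p q <= 3 / 2 + 2 * a ^+ 2.
Proof.
move=> y0 a0; case: p q => [u v] [u' v'] /=.
rewrite !ler_norml => /andP[h1 h2] /andP[h3 h4] /andP[h5 h6] /andP[h7 h8].
have -> : 3 / 2 + 2 * a ^+ 2 = 1 + (1 / 2 + 2 * a ^+ 2) by lra.
rewrite /cosh2 lerD2l /=.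
have v0 : 0 < v by lra.
have v0' : 0 < v' by lra.
have vv : 0 < 2 * v * v' by apply: mulr_gt0 => //; apply: mulr_gt0.
rewrite ler_pdivrMr //.
have d1 : (u - u') ^+ 2 <= (2 * (a * y)) ^+ 2.
  have : 0 <= (2 * (a * y) - (u - u')) * (2 * (a * y) + (u - u')) by apply: mulr_ge0; lra.
  lra.
have d2 : (v - v') ^+ 2 <= y ^+ 2.
  have : 0 <= (y - (v - v')) * (y + (v - v')) by apply: mulr_ge0; lra.
  lra.
have yy : 2 * y ^+ 2 <= 2 * v * v'.
  have : 0 <= (v - y) * (v' - y) by apply: mulr_ge0; lra.
  have : 0 <= y * (v' - y) by apply: mulr_ge0; lra.
  have : 0 <= y * (v - y) by apply: mulr_ge0; lra.
  lra.
have : (1 / 2 + 2 * a ^+ 2) * (2 * y ^+ 2) <= (1 / 2 + 2 * a ^+ 2) * (2 * v * v').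
  by rewrite ler_wpM2l //; have := sqr_ge0 a; lra.
lra.
Qed.

Lemma sys2TG_Gam (N : nat) (a : R) : 0 < a -> (3 <= N)%N ->
  3 / 2 + 2 * a ^+ 2 < 1 + N%:R ^+ 2 / 2 * (4 * (3 / 2 + 2 * a ^+ 2)) ^- 2 ->
  ((a / 2)%:E <= sys2TG (@Gam R N))%E.
Proof.
move=> a0 N3; set K := 3 / 2 + 2 * a ^+ 2 => KN.
have K1 : 1 <= K by have := sqr_ge0 a; rewrite /K; lra.
apply: le_ereal_inf_tmp => _ [L [F [surfL immF _ -> _]]].
have [g [p [gG h1 h2]]] := plane_bounded_height immF.2.
set x := (val p).1; set y := (val p).2; have y0 : 0 < y by exact: (valP p).
(* [p] is the midpoint of the lower edge, so [K] bounds the cosh of distances to [p] as well as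
   between points of [Q]. *)
pose Q : set (measurableTypeR R * measurableTypeR R) :=
  (`[x - a * y, x + a * y] `*` `[y, 2 * y])%classic.
have QP q : Q q <-> `|q.1 - x| <= a * y /\ y <= q.2 <= 2 * y.
  rewrite /Q /setX /= !in_itv /=.
  have -> : (x - a * y <= q.1 <= x + a * y) = (`|q.1 - x| <= a * y).
    by rewrite ler_norml lerBrDr addrC [in RHS]lerBlDl.
  by [].
apply: (le_trans (rectangle_area x y0 a0)).
apply: ereal_sup_ubound; exists [set q | Q (val q)]; last first.
  congr area2; apply/seteqP; split=> [_ [q Qq <-] //|q Qq].
  have q0 : 0 < q.2 by have [_ /andP[/(lt_le_trans y0)]] := (QP q).1 Qq.
  by exists (exist _ q q0).
split.
  have -> : [set val q | q in [set q : H2 R | Q (val q)]] = Q.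
    apply/seteqP; split=> [_ [q Qq <-] //|q Qq].
    have q0 : 0 < q.2 by have [_ /andP[/(lt_le_trans y0)]] := (QP q).1 Qq.
    by exists (exist _ q q0).
  by apply: measurableX; exact: measurable_itv.
move=> f b Lf /QP[b1 b2] /QP[f1 f2].
have p1 : `|(val p).1 - x| <= a * y by rewrite subrr normr0 mulr_ge0 ?(ltW a0) ?(ltW y0).
have p2 : y <= (val p).2 <= 2 * y by rewrite -/y lexx /=; lra.
apply: (immersion_injective N3 immF gG h1 h2 K1 KN Lf).
  exact: (cosh2_rectangle y0 a0 p1 p2 b1 b2).
exact: (cosh2_rectangle y0 a0 b1 b2 f1 f2).
Qed.

Lemma tg_surface_areas_Gam N : (3 <= N)%N -> tg_surface_areas (@Gam R N) !=set0.
Proof.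
move=> N3; have N0 : (0 < N)%N by exact: leq_trans N3.
exists (surface_area (@GamZ R N)), (@GamZ R N), (@vplaneH R); split=> //.
- exact: surface_group_GamZ.
- exact: vplaneH_immersion.
- exact: vplane_proper.
- exact: surface_area_GamZ_lty.
Qed.

End Systole.

Theorem corollary1p1 (R : realType) (X : R) (hX : 0 < X) :
  exists M : nat -> set 'M[R[i]]_2,
    (forall n, [/\ arithmetic_hyperbolic_3manifold (M n),
                   tg_surface_areas (M n) !=set0
                 & (X%:E < sys2TG (M n))%E]) /\
    (forall m n, m <> n -> ~ isometric_manifolds (M m) (M n)).
Proof.
(* The rectangle then has area at least a / 2 = X + 1. *)
pose a := 2 * (X + 1); have a0 : 0 < a by rewrite /a; lra.
pose K := 3 / 2 + 2 * a ^+ 2; have K1 : 1 <= K by have := sqr_ge0 a; rewrite /K; lra.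
(* From N^2 >= N > Y one gets N^2 / 2 * (4 K)^-2 > K, the condition required by [sys2TG_Gam]. *)
pose Y := 2 * (K * (4 * K) ^+ 2).
have Y0 : 0 <= Y by rewrite /Y mulr_ge0 // mulr_ge0 ?sqr_ge0 //; lra.
pose N0 := maxn 3 (Num.bound Y); pose N n := (N0 * 3 ^ n)%N.
have NN0 n : (N0 <= N n)%N by rewrite /N leq_pmulr // expn_gt0.
have N3 n : (3 <= N n)%N by apply: leq_trans (NN0 n); exact: leq_maxl.
have large n : K < 1 + (N n)%:R ^+ 2 / 2 * (4 * K) ^- 2.
  have YN : Y < (N n)%:R.
    by apply: lt_le_trans (archi_boundP Y0) _; rewrite ler_nat (leq_trans _ (NN0 n)) // leq_maxr.
  have n1 : 1 <= (N n)%:R :> R by rewrite (ler_nat _ 1) (leq_trans _ (N3 n)).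
  have K4 : 0 < (4 * K) ^+ 2 by rewrite exprn_gt0 //; lra.
  suff : K <= (N n)%:R ^+ 2 / 2 / (4 * K) ^+ 2 by lra.
  rewrite ler_pdivlMr //.
  have : (N n)%:R <= (N n)%:R ^+ 2 :> R by rewrite expr2 ler_peMl //; lra.
  by move: YN; rewrite /Y; lra.
have noniso m n : (m < n)%N -> ~ isometric_manifolds (@Gam R (N m)) (@Gam R (N n)).
  move=> mn; apply: Gam_not_isometric => //.
  by rewrite /N mulnCA leq_mul2l -expnS leq_pexp2l ?orbT.
exists (fun n => @Gam R (N n)); split=> [n|m n mn].
  split; [exact: arithmetic_hyperbolic_Gam | exact: tg_surface_areas_Gam |].
  apply: (@lt_le_trans _ _ (a / 2)%:E); last exact: sys2TG_Gam.
  by rewrite lte_fin /a; lra.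
have [mn'|nm|//] := ltngtP m n; first exact: noniso.
by move=> /isometric_sym; exact: noniso.
Qed.
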